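(* Let $X$ be a Banach space, $\Omega\in L(X)$ an isomorphism of $X$ onto itself, $T>0$, $\tau_0>0$, $x_0,x_1\in X$ and $f\in L^{1}_{\mathrm{loc}}(0,\infty;X)$. Let $$\bar x(t):=\cosh(\Omega t)x_0+\Omega^{-1}\sinh(\Omega t)x_1+\int_0^t\Omega^{-1}\sinh(\Omega(t-s))f(s)\,ds,\quad t\ge0,$$ be the mild solution of $\ddot{\bar x}-\Omega^2\bar x=f$, $\bar x(0)=x_0$, $\dot{\bar x}(0)=x_1$. For $\tau\in(0,\tau_0)$ let $\varphi(\cdot;\tau)\in C^{1}([-2\tau,0],X)$ and let $x(\cdot;\tau)$ be the unique mild solution of $\ddot x(t)-\Omega^{2}x(t-2\tau)=f(t)$ ($t\ge0$), $x=\varphi(\cdot;\tau)$ on $[-2\tau,0]$. Then there is a constant $C$ depending only on $T$, $\tau_0$, $\|\Omega\|_{L(X)}$ and $\|\Omega^{-1}\|_{L(X)}$ such that for all $\tau\in(0,\tau_0)$, $$\|x(\cdot;\tau)-\bar x\|_{C^{0}([0,T],X)}\le C\Big(\|\varphi(-2\tau;\tau)-x_0\|_X+\|\dot\varphi(0;\tau)-x_1\|_X+\tau\big(\|\varphi(\cdot;\tau)\|_{C^{1}([-2\tau,0],X)}+\|f\|_{L^{1}(0,T;X)}\big)\Big).$$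
   Context: $\cosh(\Omega t)=\tfrac12(e^{\Omega t}+e^{-\Omega t})$, $\sinh(\Omega t)=\tfrac12(e^{\Omega t}-e^{-\Omega t})$ with operator exponentials. $\|y\|_{C^{1}(I,X)}:=\max\{\sup_I\|y\|_X,\sup_I\|\dot y\|_X\}$. A mild solution of the delay problem is $x\in C^{1}([-2\tau,\infty),X)$ with $x=\varphi$ on $[-2\tau,0]$ and $\dot x(t)=\dot x(0)+\Omega^{2}\int_0^t x(s-2\tau)\,ds+\int_0^t f(s)\,ds$ for all $t\ge0$. *)

(* Defs.v *)
From HB Require Import structures.
From mathcomp Require Import all_boot all_order all_algebra.
From mathcomp Require Import all_classical all_reals all_analysis.
Set Implicit Arguments. Unset Strict Implicit. Unset Printing Implicit Defensive.
Import Order.TTheory GRing.Theory Num.Theory.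
Import numFieldNormedType.Exports.
Local Open Scope classical_set_scope.
Local Open Scope ring_scope.

Section Defs.
Context {R : realType} {X : completeNormedModType R}.

Local Notation mu := (@completed_lebesgue_measure R).
Definition Lmeasurable (A : set R) : Prop :=
  exists B : set (caratheodory_type
     (R:=R)
     (T:=lebesgue_stieltjes_measure_ocitv_type__canonical__measurable_structure_SemiRingOfSets R)
     (wlength idfun)^*%mu),
   measurable B /\ B = A.

Definition expop (Om : X -> X) (t : R) (x : X) : X :=
  limn (series (fun k : nat => (t ^+ k / (k`!)%:R) *: iter k Om x)).

Definition coshop (Om : X -> X) (t : R) (x : X) : X :=
  2^-1 *: (expop Om t x + expop Om (- t) x).

Definition sinhop (Om : X -> X) (t : R) (x : X) : X :=
  2^-1 *: (expop Om t x - expop Om (- t) x).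

Definition opnorm_is (g : X -> X) (a : R) : Prop :=
  (forall x, `|g x| <= a * `|x|) /\
  (forall M, (forall x, `|g x| <= M * `|x|) -> a <= M).

Definition sfun_eval (s : seq (set R * X)) (t : R) : X :=
  \sum_(p <- s) (\1_(p.1) t : R) *: p.2.

Definition sfun_ok (A : set R) (s : seq (set R * X)) : Prop :=
  foldr (fun p P => (Lmeasurable p.1 /\
          (mu (p.1 `&` A) < +oo)%E) /\ P) True s.

Definition sfun_int (A : set R) (s : seq (set R * X)) : X :=
  \sum_(p <- s) fine (mu (p.1 `&` A)) *: p.2.

Definition bochner (f : R -> X) (A : set R) (v : X) : Prop :=
  exists s : nat -> seq (set R * X),
    (forall n, sfun_ok A (s n)) /\
    {ae mu, forall t, A t ->
        sfun_eval (s n) t @[n --> \oo] --> f t} /\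
    (\int[mu]_(t in A) (`|f t - sfun_eval (s n) t|)%:E)%E
        @[n --> \oo] --> 0%E /\
    sfun_int A (s n) @[n --> \oo] --> v.

Definition C1on (D : set R) (x x' : R -> X) : Prop :=
  {within D, continuous x'} /\
  forall t, D t ->
    (fun h : R => h^-1 *: (x (t + h) - x t)) @ within [set h | D (t + h)] (0 : R)^'
      --> x' t.

Definition supnorm (a b : R) (g : R -> X) : R :=
  sup [set `|g t| | t in `[a, b]].

Definition C1norm (a b : R) (g g' : R -> X) : R :=
  Num.max (supnorm a b g) (supnorm a b g').

Definition L1norm (T : R) (f : R -> X) : R :=
  let A := `[0, T]%classic in
  fine (\int[mu]_(t in A) (`|f t|)%:E)%E.

(* mild solution of x''(t) - Om^2 x(t - 2 tau) = f(t), x = phi on [-2tau,0] *)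
Definition mild_delay (Om : X -> X) (f : R -> X) (tau : R) (phi : R -> X)
    (x x' : R -> X) : Prop :=
  C1on `[- (2 * tau), +oo[ x x' /\
  (forall t, - (2 * tau) <= t <= 0 -> x t = phi t) /\
  (forall t, 0 <= t -> exists v w,
      bochner (fun s => x (s - 2 * tau)) `[0, t] v /\
      bochner f `[0, t] w /\
      x' t = x' 0 + Om (Om v) + w).

End Defs.

(* Main.v *)
Require Import Defs.
From HB Require Import structures.
From mathcomp Require Import all_boot all_order all_algebra.
From mathcomp Require Import all_classical all_reals all_analysis.
From mathcomp Require Import measurable_realfun.
From mathcomp Require Import ring lra.
Import Order.TTheory GRing.Theory Num.Theory.
Import numFieldNormedType.Exports.
Local Open Scope classical_set_scope.
Local Open Scope ring_scope.
Set Implicit Arguments. Unset Strict Implicit. Unset Printing Implicit Defensive.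

(** Write K(u) = Om^-1 sinh(Om u) and fix t. For a mild solution x of the delay
    problem, s |-> cosh(Om (t - s)) x(s) + K(t - s) x'(s) formally has derivative
    K(t - s) (f(s) + Om^2 (x(s - 2 tau) - x(s))), so integrating from 0 to t gives
    x(t) - xb(t) = cosh(Om t) (phi(0) - x0) + K(t) (phi'(0) - x1)
                   + int_0^t K(t - s) Om^2 (x(s - 2 tau) - x(s)) ds.
    The last term is O(tau sup|x'|), and sup|x'| is bounded by a Gronwall argument
    with an exponential weight, uniformly in tau. Since x' need not be
    differentiable, the integration is replaced by a mean value inequality for
    increments; the Bochner integral of K(t - s) f(s) enters only through its
    approximating simple functions, whose integrals are additive over intervals. *)

(** * The completed Lebesgue integral of nonnegative functions *)

(** The comparison function [psi] of the mean value inequality is arbitrary, and this is what admits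
    an [f] that is merely integrable: [psi] contains the primitive of |f|, so on short intervals [f]
    is controlled in L1 and never pointwise. Freezing the kernel on an interval of length at most
    eta costs its Lipschitz constant times eta times the integral of |f| there; these costs add up
    to a multiple of eta, which is chosen small at the end. Uniformity in tau has two sources. A
    delayed time r - 2 tau falls either into the history, where the data bound [x], or on an earlier
    time, where the increasing exponential bound is smaller. And a Lipschitz bound for [x] on all of
    [-2 tau, T] makes x(s - 2 tau) - x(s) of size 2 tau even across s = 0. Since the identity
    involves phi(0) but the estimate phi(-2 tau), the bound on phi' is used once more, at the cost 2
    tau sup|phi'|. *)

Section NonnegIntegral.
Context d (T : measurableType d) (R : realType) (mu : {measure set T -> \bar R}).
Implicit Types (A B : set T) (g h : T -> R).

Let setIDU A B : A = (B `&` A) `|` (A `\` B).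
Proof.
apply/seteqP; split => [z Az|z [[]|[]]//].
by have [Bz|Bz] := pselect (B z); [left|right].
Qed.

Let disjID A B : (B `&` A) `&` (A `\` B) = set0.
Proof. by apply/seteqP; split => // z [[? ?] [? ?]]. Qed.

Lemma measure_setID A B : measurable A -> measurable B ->
  mu A = (mu (B `&` A) + mu (A `\` B))%E.
Proof.
move=> mA mB; rewrite {1}(setIDU A B) measureU//.
- exact: measurableI.
- exact: measurableD.
Qed.

Lemma ge0_le_integral_fin A g h : measurable A ->
  measurable_fun A g -> measurable_fun A h ->
  (forall t, A t -> 0 <= g t <= h t) ->
  (\int[mu]_(t in A) (g t)%:E <= \int[mu]_(t in A) (h t)%:E)%E.
Proof.
move=> mA mg mh gh; apply: ge0_le_integral => //.
- by move=> t /gh /andP[g0 _]; rewrite lee_fin.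
- exact/measurable_EFinP.
- exact/measurable_EFinP.
- by move=> t /gh /andP[_ ght]; rewrite lee_fin.
Qed.

Lemma ge0_integralD_fin A g h : measurable A ->
  measurable_fun A g -> measurable_fun A h ->
  (forall t, A t -> 0 <= g t) -> (forall t, A t -> 0 <= h t) ->
  (\int[mu]_(t in A) (g t + h t)%:E =
   \int[mu]_(t in A) (g t)%:E + \int[mu]_(t in A) (h t)%:E)%E.
Proof.
move=> mA mg mh g0 h0; rewrite -ge0_integralD//.
- exact/measurable_EFinP.
- exact/measurable_EFinP.
Qed.

Lemma ge0_integralZ_fin A g k : measurable A -> measurable_fun A g -> 0 <= k ->
  (forall t, A t -> 0 <= g t) ->
  (\int[mu]_(t in A) (k * g t)%:E = k%:E * \int[mu]_(t in A) (g t)%:E)%E.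
Proof.
move=> mA mg k0 g0; rewrite -ge0_integralZl_EFin//.
exact/measurable_EFinP.
Qed.

Lemma ge0_integral_setID A B g : measurable A -> measurable B ->
  measurable_fun A g -> (forall t, A t -> 0 <= g t) ->
  (\int[mu]_(t in A) (g t)%:E =
   \int[mu]_(t in B `&` A) (g t)%:E + \int[mu]_(t in A `\` B) (g t)%:E)%E.
Proof.
move=> mA mB mg g0.
rewrite {1}(setIDU A B) ge0_integral_setU//.
- exact: measurableI.
- exact: measurableD.
- by rewrite -setIDU; exact/measurable_EFinP.
- by move=> t; rewrite -setIDU => /g0.
- by rewrite disj_set2E; apply/eqP; exact: disjID.
Qed.

Lemma measurable_fun_setID A B g : measurable A -> measurable B ->
  measurable_fun (B `&` A) g -> measurable_fun (A `\` B) g -> measurable_fun A g.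
Proof.
move=> mA mB m1 m2; rewrite (setIDU A B); apply/measurable_funU => //.
- exact: measurableI.
- exact: measurableD.
Qed.

(** Off the null set [N] the limit is pointwise, hence measurable; on [N] the function [g] is
    arbitrary. Replacing it there by 0 gives a measurable function that agrees with it almost
    everywhere, and completeness of the measure carries measurability back to [g]. *)
Lemma ae_cvg_measurable_fun A (s : nat -> T -> R) g :
  measure_is_complete mu -> measurable A ->
  (forall n, measurable_fun A (s n)) ->
  {ae mu, forall t, A t -> s n t @[n --> \oo] --> g t} -> measurable_fun A g.
Proof.
move=> cmu mA ms [N [mN N0 sN]].
have mD : measurable (A `\` N) by exact: measurableD.
have mgD : measurable_fun (A `\` N) (EFin \o g).
  apply: (emeasurable_fun_cvg (fun n t => (s n t)%:E)).
    move=> n; apply/measurable_EFinP; apply: measurable_funS (ms n) => // t [].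
  move=> t [At Nt].
  apply: (@cvg_comp _ _ _ (fun n => s n t) EFin _ (nbhs (g t))) => //.
  apply: contrapT => ncv; apply: Nt; apply: sN => /= /(_ At).
  by move=> h; apply: ncv.
apply/measurable_EFinP.
apply: (ae_measurable_fun cmu
  (f := fun t => if t \in N then 0%E else (g t)%:E)).
  exists N; split => //= t /=; apply: contra_notP => Nt _.
  by rewrite memNset.
rewrite (setIDU A N); apply/measurable_funU => //; first exact: measurableI.
split.
  apply: (eq_measurable_fun (fun=> 0%E)); last exact: measurable_cst.
  by move=> t; rewrite inE => -[Nt _]; rewrite mem_set.
apply: eq_measurable_fun mgD => t; rewrite inE => -[_ Nt].
by rewrite memNset.
Qed.

End NonnegIntegral.

Section LebesgueIntegral.
Context {R : realType}.
Local Notation mu := (@completed_lebesgue_measure R).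
Local Notation lR := (caratheodory_type (R:=R)
     (T:=lebesgue_stieltjes_measure_ocitv_type__canonical__measurable_structure_SemiRingOfSets R)
     (wlength idfun)^*%mu).
Implicit Types (A B : set R) (g h : R -> R).

(** The ascription fixes the Caratheodory sigma-algebra on the line, so that [lint] and [lmfun]
    refer to Lebesgue measurability, for which the measure is complete. *)
Definition lmu : {measure set lR -> \bar R} := mu.
Definition lint A g : \bar R := (\int[lmu]_(t in A) (g t)%:E)%E.

Definition lmfun A g : Prop := measurable_fun (A : set lR) (g : lR -> R).

Lemma LmeasurableE A : Lmeasurable A -> measurable (A : set lR).
Proof. by move=> [B [mB <-]]. Qed.

Lemma Lmeasurable_of A : measurable (A : set lR) -> Lmeasurable A.
Proof. by move=> mA; exists A. Qed.

Lemma LmeasurableI A B : Lmeasurable A -> Lmeasurable B -> Lmeasurable (A `&` B).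
Proof.
by move=> /LmeasurableE mA /LmeasurableE mB; apply: Lmeasurable_of; exact: measurableI.
Qed.

Lemma LmeasurableD A B : Lmeasurable A -> Lmeasurable B -> Lmeasurable (A `\` B).
Proof.
by move=> /LmeasurableE mA /LmeasurableE mB; apply: Lmeasurable_of; exact: measurableD.
Qed.

Lemma Lmeasurable_itv (i : interval R) : Lmeasurable [set` i].
Proof.
apply: Lmeasurable_of; apply: sub_caratheodory.
exact: (measurable_itv i).
Qed.

Lemma lmu_itvcc (u v : R) : u <= v -> mu `[u, v] = (v - u)%:E.
Proof.
move=> uv; have -> : mu `[u, v] = (@lebesgue_measure R) `[u, v] by [].
rewrite lebesgue_measure_itv /= lte_fin.
by have [|vu] := ltP u v => //; rewrite (@le_anti _ _ u v) ?uv// subrr.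
Qed.

Lemma lmu_itvoc (u v : R) : u <= v -> mu `]u, v] = (v - u)%:E.
Proof.
move=> uv; have -> : mu `]u, v] = (@lebesgue_measure R) `]u, v] by [].
rewrite lebesgue_measure_itv /= lte_fin.
by have [|vu] := ltP u v => //; rewrite (@le_anti _ _ u v) ?uv// subrr.
Qed.

Lemma lmu_setID A B : Lmeasurable A -> Lmeasurable B ->
  mu A = (mu (B `&` A) + mu (A `\` B))%E.
Proof.
by move=> /LmeasurableE mA /LmeasurableE mB; exact: (@measure_setID _ lR R lmu).
Qed.

Lemma lmu_ge0 A : (0 <= mu A)%E.
Proof. exact: measure_ge0. Qed.

Lemma le_lmu A B : Lmeasurable A -> Lmeasurable B -> A `<=` B -> (mu A <= mu B)%E.
Proof.
by move=> /LmeasurableE mA /LmeasurableE mB AB; apply: le_measure => //; rewrite inE.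
Qed.

Lemma lint_ge0 A g : (forall t, A t -> 0 <= g t) -> (0 <= lint A g)%E.
Proof. by move=> g0; apply: integral_ge0 => t At; rewrite lee_fin g0. Qed.

Lemma le_lint A g h : Lmeasurable A -> lmfun A g -> lmfun A h ->
  (forall t, A t -> 0 <= g t <= h t) -> (lint A g <= lint A h)%E.
Proof.
by move=> /LmeasurableE mA; exact: (@ge0_le_integral_fin _ lR R lmu).
Qed.

Lemma lintD A g h : Lmeasurable A -> lmfun A g -> lmfun A h ->
  (forall t, A t -> 0 <= g t) -> (forall t, A t -> 0 <= h t) ->
  lint A (fun t => g t + h t) = (lint A g + lint A h)%E.
Proof.
by move=> /LmeasurableE mA; exact: (@ge0_integralD_fin _ lR R lmu).
Qed.

Lemma lintM A g k : Lmeasurable A -> lmfun A g -> 0 <= k ->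
  (forall t, A t -> 0 <= g t) ->
  lint A (fun t => k * g t) = (k%:E * lint A g)%E.
Proof.
by move=> /LmeasurableE mA; exact: (@ge0_integralZ_fin _ lR R lmu).
Qed.

Lemma lint_cst A k : Lmeasurable A -> lint A (fun _ => k) = (k%:E * mu A)%E.
Proof. by move=> /LmeasurableE mA; rewrite /lint integral_cst. Qed.

Lemma lint_setID A B g : Lmeasurable A -> Lmeasurable B -> lmfun A g ->
  (forall t, A t -> 0 <= g t) ->
  lint A g = (lint (B `&` A) g + lint (A `\` B) g)%E.
Proof.
by move=> /LmeasurableE mA /LmeasurableE mB; exact: (@ge0_integral_setID _ lR R lmu).
Qed.

Lemma lmfunS A B g : Lmeasurable A -> B `<=` A -> lmfun A g -> lmfun B g.
Proof. by move=> /LmeasurableE mA BA; exact: measurable_funS. Qed.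

Lemma lmfun_setID A B g : Lmeasurable A -> Lmeasurable B ->
  lmfun (B `&` A) g -> lmfun (A `\` B) g -> lmfun A g.
Proof.
by move=> /LmeasurableE mA /LmeasurableE mB; exact: (@measurable_fun_setID _ lR R).
Qed.

Lemma eq_lmfun A g h : (forall t, A t -> g t = h t) -> lmfun A g -> lmfun A h.
Proof.
by move=> gh; apply: eq_measurable_fun => t; rewrite inE => /gh.
Qed.

Lemma lmfun_cst A k : lmfun A (fun _ => k).
Proof. exact: measurable_cst. Qed.

Lemma lmfunD A g h : lmfun A g -> lmfun A h -> lmfun A (fun t => g t + h t).
Proof. exact: measurable_funD. Qed.

Lemma lmfunM A g k : lmfun A g -> lmfun A (fun t => k * g t).
Proof. by move=> mg; apply: measurable_funM => //; exact: measurable_cst. Qed.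

Lemma lmfun_cvg A (s : nat -> R -> R) g : Lmeasurable A ->
  (forall n, lmfun A (s n)) ->
  {ae mu, forall t, A t -> s n t @[n --> \oo] --> g t} -> lmfun A g.
Proof.
move=> /LmeasurableE mA; apply: (@ae_cvg_measurable_fun _ lR R lmu) => //.
exact: completed_lebesgue_measure_is_complete.
Qed.

End LebesgueIntegral.

(** * Bochner integrals *)

Section Bochner.
Context {R : realType} {X : completeNormedModType R}.
Local Notation mu := (@completed_lebesgue_measure R).
Implicit Types (A B : set R) (s sg : seq (set R * X)) (f g : R -> X).

(** The part of [sfun_ok] that does not mention the domain, so that one simple function can be
    integrated over varying subsets. *)
Fixpoint smeas s : Prop := if s is p :: s' then Lmeasurable p.1 /\ smeas s' else True.

Definition smap (L : X -> X) s := [seq (p.1, L p.2) | p <- s].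

Lemma sfun_ok_smeas A s : sfun_ok A s -> smeas s.
Proof. by elim: s => //= p s IH [[mp _] /IH]. Qed.

Lemma smeas_sfun_ok A s : Lmeasurable A -> (mu A < +oo)%E -> smeas s -> sfun_ok A s.
Proof.
move=> mA fA; elim: s => //= p s IH [mp /IH ok]; split => //; split => //.
by apply: le_lt_trans fA; apply: le_lmu => //; exact: LmeasurableI.
Qed.

Lemma smeas_smap L s : smeas s -> smeas (smap L s).
Proof. by elim: s => //= p s IH [mp /IH]. Qed.

Lemma smeas_cat s sg : smeas s -> smeas sg -> smeas (s ++ sg).
Proof. by elim: s => //= p s IH [mp ms] msg; split => //; exact: IH. Qed.

Lemma sfun_eval_cons p s t :
  sfun_eval (p :: s) t = (\1_(p.1) t : R) *: p.2 + sfun_eval s t.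
Proof. by rewrite /sfun_eval big_cons. Qed.

Lemma sfun_int_cons A p s :
  sfun_int A (p :: s) = fine (mu (p.1 `&` A)) *: p.2 + sfun_int A s.
Proof. by rewrite /sfun_int big_cons. Qed.

Lemma sfun_eval_cat s sg t : sfun_eval (s ++ sg) t = sfun_eval s t + sfun_eval sg t.
Proof. by rewrite /sfun_eval big_cat. Qed.

Lemma sfun_int_cat A s sg : sfun_int A (s ++ sg) = sfun_int A s + sfun_int A sg.
Proof. by rewrite /sfun_int big_cat. Qed.

Lemma sfun_eval_smap (L : {linear X -> X}) s t :
  sfun_eval (smap L s) t = L (sfun_eval s t).
Proof.
rewrite /sfun_eval big_map raddf_sum; apply: eq_bigr => p _ /=.
by rewrite linearZ.
Qed.

Lemma sfun_int_smap (L : {linear X -> X}) A s : sfun_int A (smap L s) = L (sfun_int A s).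
Proof.
rewrite /sfun_int big_map raddf_sum; apply: eq_bigr => p _ /=.
by rewrite linearZ.
Qed.

Lemma sfun_evalN s t : sfun_eval (smap -%R s) t = - sfun_eval s t.
Proof. exact: (sfun_eval_smap (GRing.opp : {linear X -> X})). Qed.

Lemma sfun_intN A s : sfun_int A (smap -%R s) = - sfun_int A s.
Proof. exact: (sfun_int_smap (GRing.opp : {linear X -> X})). Qed.

(** Measurability is stated for real norms, so [X] carries no sigma-algebra. The free constant [c]
    makes the induction work: on the head set the head vector is absorbed into [c], off it nothing
    changes. *)
Lemma lmfun_sfun A c s : Lmeasurable A -> smeas s ->
  lmfun A (fun t => `|c + sfun_eval s t|).
Proof.
elim: s A c => [A c _ _|[B x] s IH A c mA /= [mB ms]].
  apply: (@eq_lmfun _ _ (fun _ => `|c|)); last exact: lmfun_cst.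
  by move=> t _; rewrite /sfun_eval big_nil addr0.
apply: (lmfun_setID mA mB).
- apply: (@eq_lmfun _ _ (fun t => `|(c + x) + sfun_eval s t|)).
    by move=> t [Bt _]; rewrite sfun_eval_cons /= indicE mem_set// scale1r addrA.
  by apply: IH => //; exact: LmeasurableI.
- apply: (@eq_lmfun _ _ (fun t => `|c + sfun_eval s t|)).
    by move=> t [_ Bt]; rewrite sfun_eval_cons /= indicE memNset// scale0r add0r.
  by apply: IH => //; exact: LmeasurableD.
Qed.

Lemma eq_lint A (g h : R -> R) : (forall t, A t -> g t = h t) -> lint A g = lint A h.
Proof. by move=> gh; apply: eq_integral => t; rewrite inE => /gh ->. Qed.

(** Finiteness keeps [fine] additive, since [fine] sends an infinite measure to 0. *)
Lemma fine_lmu_setID A B : Lmeasurable A -> Lmeasurable B -> (mu A < +oo)%E ->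
  fine (mu A) = fine (mu (B `&` A)) + fine (mu (A `\` B)).
Proof.
move=> mA mB fA; rewrite (lmu_setID mA mB) fineD// ge0_fin_numE ?lmu_ge0//;
  apply: le_lt_trans fA; apply: le_lmu => //.
- exact: LmeasurableI.
- exact: LmeasurableD.
Qed.

Lemma sfun_int_setID A B s : Lmeasurable A -> Lmeasurable B -> (mu A < +oo)%E ->
  smeas s -> sfun_int A s = sfun_int (B `&` A) s + sfun_int (A `\` B) s.
Proof.
move=> mA mB fA; elim: s => [_|[C x] s IH /= [mC ms]].
  by rewrite /sfun_int !big_nil addr0.
rewrite !sfun_int_cons /= IH// addrACA; congr (_ + _).
rewrite -scalerDl; congr (_ *: _).
rewrite (@fine_lmu_setID (C `&` A) B)//.
- by congr (fine (mu _) + fine (mu _)); apply/seteqP; split => z /=; tauto.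
- exact: LmeasurableI.
- by apply: le_lt_trans fA; apply: le_lmu => //; exact: LmeasurableI.
Qed.

(* Induction on the list: the head set splits [A] into two pieces on each of
   which the head contributes a constant. *)
Lemma norm_sfun_int A c s : Lmeasurable A -> (mu A < +oo)%E -> smeas s ->
  (`|fine (mu A) *: c + sfun_int A s|%:E <= lint A (fun t => `|c + sfun_eval s t|)%R)%E.
Proof.
elim: s A c => [A c mA fA _|[B x] s IH A c mA fA /= [mB ms]].
  rewrite (@eq_lint _ _ (fun _ => `|c|)); last first.
    by move=> t _; rewrite /sfun_eval big_nil addr0.
  rewrite lint_cst// /sfun_int big_nil addr0 normrZ ger0_norm ?fine_ge0 ?lmu_ge0//.
  by rewrite EFinM fineK ?ge0_fin_numE ?lmu_ge0// muleC.
have mBA : Lmeasurable (B `&` A) by exact: LmeasurableI.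
have mAB : Lmeasurable (A `\` B) by exact: LmeasurableD.
have fBA : (mu (B `&` A) < +oo)%E by apply: le_lt_trans fA; exact: le_lmu.
have fAB : (mu (A `\` B) < +oo)%E by apply: le_lt_trans fA; exact: le_lmu.
rewrite (lint_setID mA mB); last 2 first.
- by apply: lmfun_sfun.
- by move=> t _; exact: normr_ge0.
rewrite (@eq_lint (B `&` A) _ (fun t => `|(c + x) + sfun_eval s t|)); last first.
  by move=> t [Bt _]; rewrite sfun_eval_cons /= indicE mem_set// scale1r addrA.
rewrite (@eq_lint (A `\` B) _ (fun t => `|c + sfun_eval s t|)); last first.
  by move=> t [_ Bt]; rewrite sfun_eval_cons /= indicE memNset// scale0r add0r.
apply: le_trans (leeD (IH _ _ mBA fBA ms) (IH _ _ mAB fAB ms)).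
rewrite -EFinD lee_fin; apply: le_trans (ler_normD _ _).
rewrite sfun_int_cons /= (sfun_int_setID mA mB fA ms) (fine_lmu_setID mA mB fA).
rewrite scalerDl scalerDr le_eqVlt; apply/orP; left; apply/eqP; congr (`|_|).
by rewrite addrACA [fine _ *: c + (_ + _)]addrCA !addrA.
Qed.

Lemma norm_sfun_intB A s sg : Lmeasurable A -> (mu A < +oo)%E -> smeas s -> smeas sg ->
  (`|sfun_int A s - sfun_int A sg|%:E
    <= lint A (fun t => `|sfun_eval s t - sfun_eval sg t|)%R)%E.
Proof.
move=> mA fA ms msg.
have := @norm_sfun_int A 0 (s ++ smap -%R sg) mA fA
  (smeas_cat ms (@smeas_smap _ _ msg)).
rewrite scaler0 add0r sfun_int_cat sfun_intN.
by under eq_lint do rewrite add0r sfun_eval_cat sfun_evalN.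
Qed.

Lemma ae_cvg_sfun_lmfun A f (s : nat -> seq (set R * X)) sg : Lmeasurable A ->
  (forall n, smeas (s n)) ->
  {ae mu, forall t, A t -> sfun_eval (s n) t @[n --> \oo] --> f t} -> smeas sg ->
  lmfun A (fun t => `|f t - sfun_eval sg t|).
Proof.
move=> mA ms ae msg.
apply: (@lmfun_cvg _ _ (fun n t => `|sfun_eval (s n) t - sfun_eval sg t|)) => //.
  move=> n; apply: (@eq_lmfun _ _ (fun t => `|0 + sfun_eval (s n ++ smap -%R sg) t|)).
    by move=> t _; rewrite add0r sfun_eval_cat sfun_evalN.
  by apply: lmfun_sfun => //; apply: smeas_cat; last exact: smeas_smap.
case: ae => N [mN N0 sN]; exists N; split => //; apply: subset_trans sN.
apply: subsetC => t /= h At; apply: cvg_norm; apply: cvgB; last exact: cvg_cst.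
exact: h.
Qed.

Lemma bochner_lmfun A f w sg : Lmeasurable A -> bochner f A w -> smeas sg ->
  lmfun A (fun t => `|f t - sfun_eval sg t|).
Proof.
move=> mA [s [ok [ae _]]] msg; apply: (@ae_cvg_sfun_lmfun _ _ s) => // n.
by have := ok n; exact: sfun_ok_smeas.
Qed.

Lemma bochner_lmfun0 A f w : Lmeasurable A -> bochner f A w -> lmfun A (fun t => `|f t|).
Proof.
move=> mA fw; apply: eq_lmfun (@bochner_lmfun A f w [::] mA fw I).
by move=> t _; rewrite /sfun_eval big_nil subr0.
Qed.

Lemma lint_norm_triangle A (h1 h2 h3 : R -> X) : Lmeasurable A ->
  lmfun A (fun t => `|h1 t - h3 t|) ->
  lmfun A (fun t => `|h1 t - h2 t|) -> lmfun A (fun t => `|h2 t - h3 t|) ->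
  (lint A (fun t => `|h1 t - h3 t|)%R
    <= lint A (fun t => `|h1 t - h2 t|)%R + lint A (fun t => `|h2 t - h3 t|)%R)%E.
Proof.
move=> mA m13 m12 m23; rewrite -lintD//; apply: le_lint => //.
- exact: lmfunD.
- by move=> t _; rewrite normr_ge0 /= ler_distD.
Qed.

(** The integrals of the sequence defining [w] tend to [w], and each is compared with that of [sg]
    by the triangle inequality in L1. As [sg] is arbitrary, a value defined by one sequence can be
    tested against any other simple function; all later estimates of Bochner integrals rest on
    this. *)
Lemma bochner_dist A f w sg : Lmeasurable A -> (mu A < +oo)%E -> bochner f A w ->
  smeas sg ->
  (`|w - sfun_int A sg|%:E <= lint A (fun t => `|f t - sfun_eval sg t|)%R)%E.
Proof.
move=> mA fA fw msg; have := fw => -[s [ok [ae [cv1 cv2]]]].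
apply/lee_addgt0Pr => e e0.
have e20 : 0 < e / 2 by rewrite divr_gt0.
have [n [n1 n2]] : exists n, `|w - sfun_int A (s n)| < e / 2 /\
    (lint A (fun t => `|f t - sfun_eval (s n) t|)%R < (e / 2)%:E)%E.
  have h1 : \forall n \near \oo, `|w - sfun_int A (s n)| < e / 2.
    by move/cvgrPdist_lt : cv2; exact.
  have h2 : \forall n \near \oo,
      (lint A (fun t => `|f t - sfun_eval (s n) t|)%R < (e / 2)%:E)%E.
    have N0 : nbhs (0%E : \bar R) [set y | (y < (e / 2)%:E)%E].
      by apply: open_ereal_lt'; rewrite lte_fin.
    exact: (cv1 _ N0).
  near \oo => n; exists n; split; near: n => //.
have msn : smeas (s n) by have := ok n; exact: sfun_ok_smeas.
have mfs : forall s, smeas s -> lmfun A (fun t => `|sfun_eval s t - f t|).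
  move=> s' ms'; apply: eq_lmfun (bochner_lmfun mA fw ms') => t _.
  exact: distrC.
have H : (`|sfun_int A (s n) - sfun_int A sg|%:E <=
     lint A (fun t => `|f t - sfun_eval sg t|)%R + (e / 2)%:E)%E.
  apply: le_trans (norm_sfun_intB mA fA msn msg) _.
  apply: le_trans (@lint_norm_triangle A _ f _ mA _ _ _) _.
  - apply: (@eq_lmfun _ _ (fun t => `|0 + sfun_eval (s n ++ smap -%R sg) t|)).
      by move=> t _; rewrite add0r sfun_eval_cat sfun_evalN.
    apply: lmfun_sfun => //; apply: smeas_cat => //; exact: smeas_smap.
  - exact: mfs.
  - exact: bochner_lmfun fw _.
  rewrite addeC leeD2l//; apply: ltW; under eq_lint do rewrite distrC.
  exact: n2.
apply: (@le_trans _ _ (`|w - sfun_int A (s n)|%:E +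
   `|sfun_int A (s n) - sfun_int A sg|%:E)%E).
  by rewrite -EFinD lee_fin ler_distD.
have -> : e%:E = ((e / 2)%:E + (e / 2)%:E)%E by rewrite -EFinD -splitr.
by rewrite addeA [leRHS]addeC leeD// lee_fin ltW.
Unshelve. all: by end_near. Qed.

End Bochner.

Lemma cvge0P {R : realType} (u : nat -> \bar R) : (forall n, 0 <= u n)%E ->
  (u @ \oo --> 0%E) <-> (forall e, 0 < e -> \forall n \near \oo, (u n < e%:E)%E).
Proof.
move=> u0; split => [cv e e0|h].
  have N0 : nbhs (0%E : \bar R) [set y | (y < e%:E)%E].
    by apply: open_ereal_lt'; rewrite lte_fin.
  exact: (cv _ N0).
have fu : \forall n \near \oo, u n \is a fin_num.
  apply: filterS (h 1 ltr01) => n un; rewrite ge0_fin_numE//.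
  exact: lt_trans un (ltry _).
apply/fine_cvgP; split => //; apply/cvgrPdist_lt => e e0.
near=> n; rewrite sub0r normrN /= ger0_norm ?fine_ge0//.
rewrite -lte_fin fineK; first by near: n; exact: h.
by near: n.
Unshelve. all: by end_near. Qed.

Section BochnerTheory.
Context {R : realType} {X : completeNormedModType R}.
Local Notation mu := (@completed_lebesgue_measure R).
Implicit Types (A B : set R) (s sg : seq (set R * X)) (f g : R -> X).

Lemma lint_subset A B (g : R -> R) : Lmeasurable A -> Lmeasurable B -> B `<=` A ->
  lmfun A g -> (forall t, A t -> 0 <= g t) -> (lint B g <= lint A g)%E.
Proof.
move=> mA mB BA mg g0; rewrite (lint_setID mA mB mg g0).
rewrite setIidl// leeDl//; apply: lint_ge0 => t [At _]; exact: g0.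
Qed.

(** The sequence [smap L (s n)] is the witness, its L1 errors growing by a factor at most [k].
    Dividing by [k + 1] covers [k = 0]. *)
Lemma bochner_map (L : {linear X -> X}) k A f w : 0 <= k ->
  (forall y, `|L y| <= k * `|y|) -> Lmeasurable A -> (mu A < +oo)%E ->
  bochner f A w -> bochner (fun t => L (f t)) A (L w).
Proof.
move=> k0 Lk mA fA fw; have := fw => -[s [ok [ae [cv1 cv2]]]].
have ms n : smeas (s n) by have := ok n; exact: sfun_ok_smeas.
have Lcvg (y : nat -> X) z : y @ \oo --> z -> L (y n) @[n --> \oo] --> L z.
  move=> /cvgrPdist_lt yz; apply/cvgrPdist_lt => e e0.
  have e1 : 0 < e / (k + 1) by rewrite divr_gt0// ltr_wpDl.
  near=> n; rewrite -linearB; apply: le_lt_trans (Lk _) _.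
  apply: (@le_lt_trans _ _ ((k + 1) * `|z - y n|)).
    by rewrite ler_wpM2r// lerDl.
  by rewrite mulrC -ltr_pdivlMr ?ltr_wpDl//; near: n; exact: yz.
have ae' : {ae mu, forall t, A t ->
    sfun_eval (smap L (s n)) t @[n --> \oo] --> L (f t)}.
  case: ae => N [mN N0 sN]; exists N; split => //; apply: subset_trans sN.
  apply: subsetC => t /= h At; under eq_fun do rewrite sfun_eval_smap.
  by apply: Lcvg; exact: h.
exists (fun n => smap L (s n)); split; last split; last split => //.
- by move=> n; apply: smeas_sfun_ok => //; exact: smeas_smap.
- exact: ae'.
- apply: (proj2 (@cvge0P R
      (fun n => lint A (fun t => `|L (f t) - sfun_eval (smap L (s n)) t|)) _)).
    by move=> n; exact: lint_ge0.
  move=> e e0.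
  have e1 : 0 < e / (k + 1) by rewrite divr_gt0// ltr_wpDl.
  have nn n : (0 <= lint A (fun t => `|f t - sfun_eval (s n) t|)%R)%E.
    by apply: lint_ge0.
  have cv1' : lint A (fun t => `|f t - sfun_eval (s n) t|) @[n --> \oo] --> 0%E.
    exact: cv1.
  have := (cvge0P nn).1 cv1' _ e1; apply: filterS => n hn.
  apply: (@le_lt_trans _ _ ((k + 1)%:E *
      lint A (fun t => `|f t - sfun_eval (s n) t|)%R)%E).
    rewrite -lintM//; last 2 first.
    - exact: bochner_lmfun fw _.
    - by rewrite addr_ge0.
    apply: le_lint => //.
    - apply: (ae_cvg_sfun_lmfun _ _ ae') => //; last exact: smeas_smap.
      by move=> m; exact: smeas_smap.
    - by apply: lmfunM; exact: bochner_lmfun fw _.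
    - move=> t _; rewrite normr_ge0 /= sfun_eval_smap -linearB.
      by apply: le_trans (Lk _) _; rewrite ler_wpM2r// lerDl.
  by rewrite -lte_pdivlMl ?ltr_wpDl// -EFinM mulrC.
- by under eq_fun do rewrite sfun_int_smap; exact: Lcvg.
Unshelve. all: by end_near. Qed.

(** The sequence of [w2] serves on the difference set. Its integrals over [B] tend to [w1], although
    [w1] may come from another sequence, because [bochner_dist] compares [w1] with any simple
    function. *)
Lemma bochner_setD A B f w1 w2 : Lmeasurable A -> (mu A < +oo)%E -> Lmeasurable B ->
  B `<=` A -> bochner f B w1 -> bochner f A w2 -> bochner f (A `\` B) (w2 - w1).
Proof.
move=> mA fA mB BA fw1 fw2; have := fw2 => -[s [ok [ae [cv1 cv2]]]].
have ms n : smeas (s n) by have := ok n; exact: sfun_ok_smeas.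
have mAB := LmeasurableD mA mB.
have fB : (mu B < +oo)%E by apply: le_lt_trans fA; exact: le_lmu.
have fAB : (mu (A `\` B) < +oo)%E by apply: le_lt_trans fA; exact: le_lmu.
have nn n : (0 <= lint A (fun t => `|f t - sfun_eval (s n) t|)%R)%E.
  by apply: lint_ge0.
have cvA : lint A (fun t => `|f t - sfun_eval (s n) t|) @[n --> \oo] --> 0%E.
  exact: cv1.
have cvA' := (cvge0P nn).1 cvA.
have le C n : Lmeasurable C -> C `<=` A ->
   (lint C (fun t => `|f t - sfun_eval (s n) t|)%R
    <= lint A (fun t => `|f t - sfun_eval (s n) t|)%R)%E.
  by move=> mC CA; apply: lint_subset => //; exact: bochner_lmfun fw2 _.
exists s; split; last split; last split => //.
- by move=> n; apply: smeas_sfun_ok.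
- case: ae => N [mN N0 sN]; exists N; split => //; apply: subset_trans sN.
  by apply: subsetC => t /= h [At _]; exact: h.
- apply: (proj2 (@cvge0P R
      (fun n => lint (A `\` B) (fun t => `|f t - sfun_eval (s n) t|)) _)).
    by move=> n; exact: lint_ge0.
  move=> e e0.
  apply: filterS (cvA' e e0) => n; apply: le_lt_trans.
  by apply: (le (A `\` B)) => // t [].
- have -> : (fun n => sfun_int (A `\` B) (s n)) =
      (fun n => sfun_int A (s n) - sfun_int B (s n)).
    apply/funext => n; rewrite (sfun_int_setID mA mB fA (ms n)) setIidl//.
    by rewrite addrC addKr.
  apply: cvgB => //; apply/cvgrPdist_lt => e e0.
  apply: filterS (cvA' e e0) => n hn; rewrite -lte_fin; apply: le_lt_trans hn.
  by apply: le_trans (le B n mB BA); exact: bochner_dist.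
Qed.

Lemma sfun_eval_bounded s : exists M, forall t, `|sfun_eval s t| <= M.
Proof.
elim: s => [|[B x] s [M IH]].
  by exists 0 => t; rewrite /sfun_eval big_nil normr0.
exists (`|x| + M) => t; rewrite sfun_eval_cons; apply: le_trans (ler_normD _ _) _.
rewrite lerD// normrZ /= indicE ler_piMl//.
by case: (_ \in _); rewrite ?normr1 ?normr0.
Qed.

(** Convergence of the L1 errors to 0 makes at least one of them smaller than 1; the difference of
    two simple functions is bounded, hence integrable on a set of finite measure. *)
Lemma bochner_lint_lty A f w sg : Lmeasurable A -> (mu A < +oo)%E -> bochner f A w ->
  smeas sg -> (lint A (fun t => `|f t - sfun_eval sg t|)%R < +oo)%E.
Proof.
move=> mA fA fw msg; have := fw => -[s [ok [ae [cv1 cv2]]]].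
have ms n : smeas (s n) by have := ok n; exact: sfun_ok_smeas.
have nn n : (0 <= lint A (fun t => `|f t - sfun_eval (s n) t|)%R)%E.
  by apply: lint_ge0.
have cvA : lint A (fun t => `|f t - sfun_eval (s n) t|) @[n --> \oo] --> 0%E.
  exact: cv1.
have [n hn] : exists n, (lint A (fun t => `|f t - sfun_eval (s n) t|)%R < 1%:E)%E.
  have h := (cvge0P nn).1 cvA _ ltr01.
  by near \oo => n; exists n; near: n.
have [M1 hM1] := sfun_eval_bounded (s n); have [M2 hM2] := sfun_eval_bounded sg.
have ml : lmfun A (fun t => `|sfun_eval (s n) t - sfun_eval sg t|).
  apply: (@eq_lmfun _ _ (fun t => `|0 + sfun_eval (s n ++ smap -%R sg) t|)).
    by move=> t _; rewrite add0r sfun_eval_cat sfun_evalN.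
  by apply: lmfun_sfun => //; apply: smeas_cat => //; exact: smeas_smap.
have H := @lint_norm_triangle _ _ A f (sfun_eval (s n)) (sfun_eval sg) mA
  (bochner_lmfun mA fw msg) (bochner_lmfun mA fw (ms n)) ml.
apply: le_lt_trans H _; apply: lte_add_pinfty; first exact: lt_trans hn (ltry _).
apply: (@le_lt_trans _ _ (lint A (fun=> M1 + M2)%R)).
  apply: le_lint => //; first exact: lmfun_cst.
  move=> t _; rewrite normr_ge0 /=; apply: le_trans (ler_normB _ _) _.
  exact: lerD.
rewrite lint_cst//; have -> : mu A = (fine (mu A))%:E.
  by rewrite fineK// ge0_fin_numE ?lmu_ge0.
by rewrite -EFinM ltry.
Unshelve. all: by end_near. Qed.

End BochnerTheory.

(** * Primitives of Bochner integrable functions and their increments *)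

Section BochnerPrimitive.
Context {R : realType} {X : completeNormedModType R}.
Local Notation mu := (@completed_lebesgue_measure R).
Implicit Types (f g : R -> X) (sg : seq (set R * X)) (h : R -> R) (t u v : R).

(** Real-valued, so that increments of the primitive can be formed; [fine] returns 0 on an infinite
    integral, hence the finiteness checks below. *)
Definition rint t h : R := fine (lint `[0, t] h).

Lemma lmu_itv0_lty t : 0 <= t -> (mu `[0%R, t] < +oo)%E.
Proof. by move=> t0; rewrite lmu_itvcc// ltry. Qed.

Lemma itv0_subset u v : u <= v -> `[0, u] `<=` `[0, v].
Proof. by move=> uv r /=; rewrite !in_itv /= => /andP[-> /le_trans]; exact. Qed.

Lemma itv0_setD u v : 0 <= u -> `[0, v]%classic `\` `[0, u]%classic = `]u, v]%classic.
Proof.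
move=> u0; apply/seteqP; split => r /=; rewrite !in_itv /=.
  by move=> [/andP[r0 ->] /negP]; rewrite r0 /= -ltNge => ->.
move=> /andP[ur rv]; rewrite rv (le_trans u0 (ltW ur)); split => //.
by apply/negP; rewrite -ltNge.
Qed.

Lemma bochner_norm t f w : 0 <= t -> bochner f `[0, t] w ->
  `|w| <= rint t (fun r => `|f r|).
Proof.
move=> t0 fw; have mA := Lmeasurable_itv `[0, t]; have fA := lmu_itv0_lty t0.
have E : lint `[0, t] (fun r => `|f r - sfun_eval [::] r|) = lint `[0, t] (fun r => `|f r|).
  by apply: eq_lint => r _; rewrite /sfun_eval big_nil subr0.
have fin := @bochner_lint_lty _ _ _ f w [::] mA fA fw I.
have := @bochner_dist _ _ _ f w [::] mA fA fw I.
rewrite E in fin *; rewrite /sfun_int big_nil subr0 -lee_fin fineK//.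
by rewrite ge0_fin_numE// lint_ge0.
Qed.

(** This is [bochner_dist] against the constant [c]. With [c = 0] it bounds an integral; with [c]
    close to [f] it linearises the increment of a primitive. *)
Lemma bochner_sfun_bound (A : set R) f w c M : Lmeasurable A -> (mu A < +oo)%E ->
  bochner f A w -> (forall r, A r -> `|f r - c| <= M) ->
  `|w - fine (mu A) *: c| <= M * fine (mu A).
Proof.
move=> mA fA fw fM; pose sg : seq (set R * X) := [:: (setT, c)].
have msg : smeas sg.
  by split => //=; have := @Lmeasurable_itv R `]-oo, +oo[; rewrite set_itvE.
have Ev r : sfun_eval sg r = c.
  by rewrite /sfun_eval big_seq1 /= indicE mem_set// scale1r.
have := bochner_dist mA fA fw msg; rewrite {1}/sfun_int big_seq1 /= setTI => H.
rewrite -lee_fin; apply: le_trans H _.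
apply: (@le_trans _ _ (lint A (fun=> M))).
  apply: le_lint => //; first exact: bochner_lmfun fw msg.
    exact: lmfun_cst.
  by move=> r Ar; rewrite normr_ge0 /= Ev fM.
by rewrite lint_cst// EFinM fineK// ge0_fin_numE// lmu_ge0.
Qed.

Lemma bochner_norm_cst t f w M : 0 <= t -> bochner f `[0, t] w ->
  (forall r, 0 <= r <= t -> `|f r| <= M) -> `|w| <= M * t.
Proof.
move=> t0 fw fM.
have := @bochner_sfun_bound `[0, t] f w 0 M (Lmeasurable_itv _) (lmu_itv0_lty t0) fw.
rewrite lmu_itvcc//= !subr0 scaler0 subr0; apply => r.
by rewrite subr0 /= in_itv /= => /fM.
Qed.

Lemma bochner_incr u v f w1 w2 : 0 <= u <= v -> bochner f `[0, u] w1 ->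
  bochner f `[0, v] w2 -> bochner f `]u, v] (w2 - w1).
Proof.
move=> /andP[u0 uv] fw1 fw2; rewrite -itv0_setD//; apply: bochner_setD => //.
- exact: Lmeasurable_itv.
- exact: lmu_itv0_lty (le_trans u0 uv).
- exact: Lmeasurable_itv.
- exact: itv0_subset.
Qed.

Lemma bochner_incr_cst u v f w1 w2 c M : 0 <= u <= v -> bochner f `[0, u] w1 ->
  bochner f `[0, v] w2 -> (forall r, u < r <= v -> `|f r - c| <= M) ->
  `|w2 - w1 - (v - u) *: c| <= M * (v - u).
Proof.
move=> uv fw1 fw2 fM; have fw := bochner_incr uv fw1 fw2.
case/andP: uv => u0 uv.
have fA : (mu `]u, v] < +oo)%E by rewrite lmu_itvoc// ltry.
have := @bochner_sfun_bound `]u, v] f _ c M (Lmeasurable_itv _) fA fw.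
by rewrite lmu_itvoc//=; apply => r /=; rewrite in_itv /= => /fM.
Qed.

(** Brings the L1 error over []u, v]] into the form [psi v - psi u] demanded by
    [mean_value_ineq]. *)
Lemma lint_itvoc u v t f w sg : 0 <= u <= v -> v <= t -> bochner f `[0, t] w ->
  smeas sg -> lint `]u, v] (fun r => `|f r - sfun_eval sg r|) =
  (rint v (fun r => `|f r - sfun_eval sg r|)
    - rint u (fun r => `|f r - sfun_eval sg r|))%:E.
Proof.
move=> /andP[u0 uv] vt fw msg; set h := (fun r => `|f r - _|).
have v0 := le_trans u0 uv; have t0 := le_trans v0 vt.
have mt := Lmeasurable_itv `[0, t]; have mv := Lmeasurable_itv `[0, v].
have mu' := Lmeasurable_itv `[0, u].
have mht : lmfun `[0, t] h by exact: bochner_lmfun fw msg.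
have mh : lmfun `[0, v] h by apply: lmfunS mht => //; exact: itv0_subset.
have ft : (lint `[0%R, t] h < +oo)%E.
  by apply: bochner_lint_lty fw msg => //; exact: lmu_itv0_lty.
have fin r : r <= t -> (lint `[0%R, r] h < +oo)%E.
  move=> rt; apply: le_lt_trans ft; apply: lint_subset => //.
  - exact: Lmeasurable_itv.
  - exact: itv0_subset.
  - by move=> z _; exact: normr_ge0.
have fv := fin _ vt; have fu := fin _ (le_trans uv vt).
have nn (A : set R) : (0 <= lint A h)%E.
  by apply: lint_ge0 => r _; exact: normr_ge0.
have := @lint_setID R `[0, v] `[0, u] h mv mu' mh (fun r _ => normr_ge0 _).
rewrite setIidl; last exact: itv0_subset.
rewrite itv0_setD// EFinB /rint !fineK ?ge0_fin_numE// => ->.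
by rewrite [X in (X - _)%E]addeC addeK// ge0_fin_numE.
Qed.

Lemma lint_itvoc0 u v t f w : 0 <= u <= v -> v <= t -> bochner f `[0, t] w ->
  lint `]u, v] (fun r => `|f r|) =
  (rint v (fun r => `|f r|) - rint u (fun r => `|f r|))%:E.
Proof.
move=> uv vt fw; have := @lint_itvoc u v t f w [::] uv vt fw I.
rewrite /sfun_eval; have -> : (fun r => `|f r - \sum_(p <- [::]) (\1_(p.1) r : R) *: p.2|)
  = (fun r => `|f r|) by apply/funext => r; rewrite big_nil subr0.
by [].
Qed.

Lemma rint_ge0 t h : (forall r, 0 <= h r) -> 0 <= rint t h.
Proof. by move=> h0; rewrite fine_ge0// lint_ge0. Qed.

Lemma le_rint u v f w : 0 <= u <= v -> bochner f `[0, v] w ->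
  rint u (fun r => `|f r|) <= rint v (fun r => `|f r|).
Proof.
move=> uv fw.
rewrite -subr_ge0 -lee_fin -(lint_itvoc0 uv (lexx v) fw).
by apply: lint_ge0 => r _; exact: normr_ge0.
Qed.

(* Over [(u, v]] the kernel is frozen at a fixed operator [L], at the cost
   [k int |f|]; the second error term is the distance from [g] to [sg]. *)
Lemma bochner_incr_kernel u v t (L : {linear X -> X}) kL k f g w1 w2 wg sg :
  0 <= u <= v -> v <= t -> 0 <= kL -> (forall y, `|L y| <= kL * `|y|) -> 0 <= k ->
  bochner f `[0, u] w1 -> bochner f `[0, v] w2 -> bochner g `[0, t] wg -> smeas sg ->
  (forall r, u < r <= v -> `|L (f r) - g r| <= k * `|f r|) ->
  `|L (w2 - w1) - (sfun_int `[0, v] sg - sfun_int `[0, u] sg)| <=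
    k * (rint v (fun r => `|f r|) - rint u (fun r => `|f r|)) +
    (rint v (fun r => `|g r - sfun_eval sg r|) - rint u (fun r => `|g r - sfun_eval sg r|)).
Proof.
move=> uv vt kL0 LkL k0 fw1 fw2 gw msg Lk.
have /andP[u0 uv'] := uv; have v0 := le_trans u0 uv'; have t0 := le_trans v0 vt.
have mv := Lmeasurable_itv `[0, v]; have mu' := Lmeasurable_itv `[0, u].
have muv := Lmeasurable_itv `]u, v].
have fuv : (mu `]u, v] < +oo)%E by rewrite lmu_itvoc// ltry.
have Lf := bochner_map kL0 LkL muv fuv (bochner_incr uv fw1 fw2).
have -> : sfun_int `[0, v] sg - sfun_int `[0, u] sg = sfun_int `]u, v] sg.
  rewrite (@sfun_int_setID _ _ `[0, v] `[0, u])//; last exact: lmu_itv0_lty.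
  rewrite (setIidl (itv0_subset uv')) (itv0_setD v u0).
  by rewrite [LHS]addrAC subrr add0r.
have mf : lmfun `[0, v] (fun r => `|f r|) by exact: (bochner_lmfun0 mv fw2).
have mg : lmfun `[0, t] (fun r => `|g r - sfun_eval sg r|).
  exact: (bochner_lmfun (Lmeasurable_itv _) gw msg).
have sub : `]u, v] `<=` `[0, v].
  by move=> r /=; rewrite !in_itv /= => /andP[/ltW/(le_trans u0) -> ->].
have mg' : lmfun `]u, v] (fun r => `|g r - sfun_eval sg r|).
  apply: lmfunS mg; first exact: Lmeasurable_itv.
  by apply: subset_trans sub _; exact: itv0_subset.
have mf' : lmfun `]u, v] (fun r => `|f r|) by exact: (lmfunS mv sub mf).
have H := bochner_dist muv fuv Lf msg.
rewrite -lee_fin; apply: le_trans H _.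
apply: (@le_trans _ _ (lint `]u, v]
   (fun r => k * `|f r| + `|g r - sfun_eval sg r|))).
  apply: le_lint => //.
  - exact: (bochner_lmfun muv Lf msg).
  - by apply: lmfunD => //; exact: lmfunM.
  - move=> r /=; rewrite in_itv /= => /Lk h; rewrite normr_ge0 /=.
    by apply: le_trans (ler_distD (g r) _ _) _; rewrite lerD2r.
rewrite lintD//; first rewrite lintM//.
- by rewrite (lint_itvoc uv vt gw msg) (lint_itvoc0 uv (lexx v) fw2) -EFinM -EFinD.
- exact: lmfunM.
- by move=> r _; rewrite mulr_ge0.
Qed.

End BochnerPrimitive.

(** * Operator exponentials *)

Section OperatorExponential.
Context {R : realType} {X : completeNormedModType R}.
Variables (Om : {linear X -> X}) (a : R).
Hypotheses (a0 : 0 <= a) (Oma : forall y, `|Om y| <= a * `|y|).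
Implicit Types (t h S : R) (x y : X).

Lemma cvg_norm_le (u : nat -> X) l M : u @ \oo --> l -> (forall n, `|u n| <= M) ->
  `|l| <= M.
Proof.
move=> ul uM; have cn : `|u n| @[n --> \oo] --> `|l| by exact: cvg_norm.
rewrite -(cvg_lim _ cn)//; apply: limr_le; first by apply/cvg_ex; exists `|l|.
exact: nearW.
Qed.

Lemma sum_exp_coeff_le S n : 0 <= S -> \sum_(0 <= k < n) (S ^+ k / k`!%:R) <= expR S.
Proof.
move=> S0; apply: (@nondecreasing_cvgn_le R (series (exp_coeff S))).
  by apply: nondecreasing_series => k _ _; exact: exp_coeff_ge0.
exact: is_cvg_series_exp_coeff.
Qed.

Lemma norm_iter k x : `|iter k Om x| <= a ^+ k * `|x|.
Proof.
elim: k => [|k IH]; first by rewrite expr0 mul1r.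
rewrite iterS; apply: le_trans (Oma _) _.
by rewrite exprS -mulrA ler_wpM2l.
Qed.

Local Notation E n t x :=
  (series (fun k : nat => (t ^+ k / (k`!)%:R) *: iter k Om x) n).

Lemma norm_term_le k c S x : `|c| <= S ^+ k ->
  `|(c / k`!%:R) *: iter k Om x| <= ((S * a) ^+ k / k`!%:R) * `|x|.
Proof.
move=> cS; rewrite normrZ normrM normfV (@ger0_norm _ k`!%:R)//.
apply: (@le_trans _ _ ((S ^+ k / k`!%:R) * (a ^+ k * `|x|))).
  by apply: ler_pM; [rewrite mulr_ge0|exact: normr_ge0|rewrite ler_wpM2r|exact: norm_iter].
by rewrite exprMn mulrA [_ / _ * a ^+ k]mulrAC.
Qed.

(** The coefficients are general so that the bound serves both the exponential series and the series
    of its Taylor remainder. *)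
Lemma norm_sum_term_le (c : nat -> R) S x n : 0 <= S ->
  (forall k, `|c k| <= S ^+ k) ->
  `|\sum_(0 <= k < n) (c k / k`!%:R) *: iter k Om x| <= expR (S * a) * `|x|.
Proof.
move=> S0 cS; apply: le_trans (ler_norm_sum _ _ _) _.
apply: (@le_trans _ _ (\sum_(0 <= k < n) (((S * a) ^+ k / k`!%:R) * `|x|))).
  by apply: ler_sum => k _; exact: norm_term_le.
by rewrite -mulr_suml ler_wpM2r// sum_exp_coeff_le// mulr_ge0.
Qed.

(** Normal convergence in the complete space [X]; it gives the [limn] in [expop] its meaning. *)
Lemma cvg_expop t x : E n t x @[n --> \oo] --> expop Om t x.
Proof.
apply: (@normed_cvg R X (fun k : nat => (t ^+ k / (k`!)%:R) *: iter k Om x)).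
apply: (@series_le_cvg R _ (fun k => ((`|t| * a) ^+ k / k`!%:R) * `|x|)).
- by move=> k; exact: normr_ge0.
- by move=> k; rewrite mulr_ge0// divr_ge0// exprn_ge0// mulr_ge0.
- by move=> k; apply: norm_term_le; rewrite normrX.
have -> : series (fun k => ((`|t| * a) ^+ k / k`!%:R) * `|x|) =
    (fun n => series (exp_coeff (`|t| * a)) n * `|x|).
  by apply/funext => n; rewrite /series /= mulr_suml.
by apply: is_cvgM; [exact: is_cvg_series_exp_coeff|exact: is_cvg_cst].
Qed.

Lemma norm_expop t x : `|expop Om t x| <= expR (`|t| * a) * `|x|.
Proof.
apply: cvg_norm_le (@cvg_expop t x) _ => n.
by apply: norm_sum_term_le => // k; rewrite normrX.
Qed.

Lemma cvg_Om (u : nat -> X) l : u @ \oo --> l -> Om (u n) @[n --> \oo] --> Om l.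
Proof.
move=> /cvgrPdist_lt ul; apply/cvgrPdist_lt => e e0.
have e1 : 0 < e / (a + 1) by rewrite divr_gt0// ltr_wpDl.
near=> n; rewrite -linearB; apply: le_lt_trans (Oma _) _.
apply: (@le_lt_trans _ _ ((a + 1) * `|l - u n|)).
  by rewrite ler_wpM2r// lerDl.
by rewrite mulrC -ltr_pdivlMr ?ltr_wpDl//; near: n; exact: ul.
Unshelve. all: by end_near. Qed.

Lemma iter_linear k : linear (iter k Om).
Proof.
move=> c x y; elim: k => [//|k IH]; by rewrite !iterS IH linearP.
Qed.

Lemma expop_linear t : linear (expop Om t).
Proof.
move=> c x y.
have h1 := @cvg_expop t (c *: x + y).
have h2 : E n t (c *: x + y) @[n --> \oo] --> c *: expop Om t x + expop Om t y.
  have -> : (fun n => E n t (c *: x + y)) = (fun n => c *: E n t x + E n t y).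
    apply/funext => n; rewrite /series /= scaler_sumr -big_split /=.
    apply: eq_bigr => k _; rewrite iter_linear scalerDr !scalerA.
    by rewrite [c * _]mulrC.
  by apply: cvgD; [apply: cvgZr; exact: cvg_expop|exact: cvg_expop].
by have := cvg_unique _ h1 h2; apply.
Qed.

Lemma expop_comm t x : expop Om t (Om x) = Om (expop Om t x).
Proof.
have h1 := @cvg_expop t (Om x).
have h2 := cvg_Om (@cvg_expop t x).
have E1 : (fun n => E n t (Om x)) = (fun n => Om (E n t x)).
  apply/funext => n; rewrite /series /= raddf_sum; apply: eq_bigr => k _.
  by rewrite -iterSr /= linearZ.
by rewrite E1 in h1; exact: (cvg_unique _ h1 h2).
Qed.

Lemma expop0 x : expop Om 0 x = x.
Proof.
have h := @cvg_expop 0 x.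
(* Shifted by one because the empty partial sum is 0; from the first term on, where [0 ^+ 0 = 1],
   the sums are constantly [x]. *)
have h0 : E n.+1 0 x @[n --> \oo] --> x.
  have -> : (fun n => E n.+1 0 x) = (fun _ => x).
    apply/funext => n; rewrite /series /= big_nat_recl//= big1 ?addr0.
      by rewrite expr0 fact0 divr1 scale1r.
    by move=> k _; rewrite expr0n mul0r scale0r.
  exact: cvg_cst.
rewrite cvg_shiftS in h0.
exact: (cvg_unique _ h h0).
Qed.

(** The remainders satisfy d(k+1) = (t + h) d(k) + k t^(k-1) h^2. Both summands are at most S (2S)^k
    h^2, by k <= 2^k and S >= 1, and the factor 2 in the base absorbs their sum. *)
Lemma taylor_pow_le t h S k : 1 <= S -> `|t| <= S -> `|t + h| <= S ->
  `|(t + h) ^+ k - t ^+ k - k%:R * h * t ^+ k.-1| <= (2 * S) ^+ k * h ^+ 2.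
Proof.
move=> S1 tS thS; have S0 : 0 <= S by lra.
elim: k => [|k IH]; first by rewrite !expr0 subrr !mul0r subr0 normr0 mul1r sqr_ge0.
have -> : (t + h) ^+ k.+1 - t ^+ k.+1 - k.+1%:R * h * t ^+ k.+1.-1 =
    (t + h) * ((t + h) ^+ k - t ^+ k - k%:R * h * t ^+ k.-1)
    + k%:R * t ^+ k.-1 * h ^+ 2.
  case: k {IH} => [|k] /=.
    rewrite !expr1 !expr0 !mul0r subr0 subrr mulr0 !addr0 mul1r mulr1.
    by rewrite [t + h]addrC addrK subrr.
  by rewrite !exprS; ring.
have -> : (2 * S) ^+ k.+1 * h ^+ 2 =
    S * ((2 * S) ^+ k * h ^+ 2) + S * ((2 * S) ^+ k * h ^+ 2).
  by rewrite [in LHS]exprS; move: ((2 * S) ^+ k) (h ^+ 2) => p q; ring.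
apply: le_trans (ler_normD _ _) _.
apply: lerD; first by rewrite normrM; apply: ler_pM.
rewrite normrM (@ger0_norm _ (h ^+ 2)) ?sqr_ge0// mulrA ler_wpM2r ?sqr_ge0//.
rewrite normrM normrX ger0_norm//.
apply: (@le_trans _ _ (2 ^+ k * S ^+ k)).
  apply: ler_pM; [exact: ler0n|exact: exprn_ge0| |].
    by rewrite -natrX ler_nat ltnW// ltn_expl.
  apply: (@le_trans _ _ (S ^+ k.-1)); first by rewrite lerXn2r ?nnegrE.
  by rewrite ler_weXn2l// leq_pred.
by rewrite -exprMn ler_peMl// exprn_ge0// mulr_ge0.
Qed.

(** After division by [h ^+ 2] the coefficients of the remainder series are bounded by
    [(2 * S) ^+ k], so [norm_sum_term_le] sums them to an exponential. *)
Lemma expop_taylor t h S x : 1 <= S -> `|t| <= S -> `|t + h| <= S ->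
  `|expop Om (t + h) x - expop Om t x - h *: Om (expop Om t x)|
    <= h ^+ 2 * (expR (2 * S * a) * `|x|).
Proof.
move=> S1 tS thS; have S0 : 0 <= S by lra.
(* Differentiating the term of degree k + 1 gives [Om] of the term of degree k, so n + 1 terms of
   the exponentials match n terms of the derivative. *)
have h1 : (E n.+1 (t + h) x - E n.+1 t x - h *: Om (E n t x)) @[n --> \oo] -->
    expop Om (t + h) x - expop Om t x - h *: Om (expop Om t x).
  apply: cvgB; [apply: cvgB|apply: cvgZr].
  - by have := @cvg_expop (t + h) x; rewrite -cvg_shiftS.
  - by have := @cvg_expop t x; rewrite -cvg_shiftS.
  - by apply: cvg_Om; exact: cvg_expop.
apply: cvg_norm_le h1 _ => n.
pose d k := (t + h) ^+ k - t ^+ k - k%:R * h * t ^+ k.-1.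
have -> : E n.+1 (t + h) x - E n.+1 t x - h *: Om (E n t x) =
   \sum_(0 <= k < n.+1) (d k / k`!%:R) *: iter k Om x.
  have -> : h *: Om (E n t x) =
     \sum_(0 <= k < n.+1) (k%:R * h * t ^+ k.-1 / k`!%:R) *: iter k Om x.
    rewrite big_nat_recl//= !mul0r scale0r add0r.
    rewrite /series /= raddf_sum scaler_sumr; apply: eq_bigr => k _.
    rewrite /= linearZ /= scalerA; congr (_ *: _).
    have q0 : k`!%:R != 0 :> R by rewrite pnatr_eq0 -lt0n fact_gt0.
    have p0 : k.+1%:R != 0 :> R by rewrite pnatr_eq0.
    rewrite factS natrM; move: (k.+1%:R) (k`!%:R) (t ^+ k) p0 q0 => p q r p0 q0.
    by field; rewrite p0 q0.
  rewrite /series /= -!sumrB; apply: eq_bigr => k _.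
  by rewrite /d !mulrBl !scalerBl.
have [h00|hn0] := eqVneq h 0.
  rewrite /d h00 expr0n /= mul0r big1 ?normr0// => k _.
  by rewrite addr0 subrr mulr0 mul0r subr0 mul0r scale0r.
have h2 : 0 < h ^+ 2 by rewrite exprn_even_gt0.
have -> : \sum_(0 <= k < n.+1) (d k / k`!%:R) *: iter k Om x =
   h ^+ 2 *: \sum_(0 <= k < n.+1) ((d k / h ^+ 2) / k`!%:R) *: iter k Om x.
  rewrite scaler_sumr; apply: eq_bigr => k _; rewrite scalerA; congr (_ *: _).
  have q0 : k`!%:R != 0 :> R by rewrite pnatr_eq0 -lt0n fact_gt0.
  by field; rewrite hn0 q0.
rewrite normrZ (@ger0_norm _ (h ^+ 2)) ?(ltW h2)// ler_pM2l//.
apply: norm_sum_term_le; first by rewrite mulr_ge0.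
move=> k; rewrite normrM normfV (@ger0_norm _ (h ^+ 2)) ?(ltW h2)//.
by rewrite ler_pdivrMr//; exact: taylor_pow_le.
Qed.

End OperatorExponential.

(** Sorts a hyperbolic Taylor remainder into its exponential parts at [u] and at [- u]. *)
Lemma regroup6 (V : zmodType) (p q r s c d : V) :
  p + q - (r + s) - (c - d) = (p - r - c) + (q - s + d).
Proof.
rewrite [RHS]addrACA [p - r + _]addrACA -opprD; congr (_ + _).
by rewrite opprB addrC.
Qed.

(** * Hyperbolic operator functions and the Duhamel kernel *)

Section OperatorHyperbolic.
Context {R : realType} {X : completeNormedModType R}.
Variables (Om : {linear X -> X}) (Omi : X -> X) (a b S : R).
Hypotheses (OmK : cancel Om Omi) (OmiK : cancel Omi Om).
Hypotheses (a0 : 0 <= a) (Oma : forall y, `|Om y| <= a * `|y|).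
Hypotheses (b0 : 0 <= b) (Omib : forall y, `|Omi y| <= b * `|y|).
Hypothesis S1 : 1 <= S.
Implicit Types (u h : R) (x y : X).

Definition Kop u x : X := Omi (sinhop Om u x).

Local Notation M := (expR (2 * S * a)).

Let Omi_linear : linear Omi. Proof. exact: can2_linear OmK OmiK. Qed.
Let OmiL : {linear X -> X} := HB.pack Omi (GRing.isLinear.Build R X X *:%R Omi Omi_linear).

Let OmZ c y : Om (c *: y) = c *: Om y. Proof. exact: linearZ. Qed.
Let OmD x y : Om (x + y) = Om x + Om y. Proof. exact: linearD. Qed.
Let OmB x y : Om (x - y) = Om x - Om y. Proof. exact: linearB. Qed.

Let OmiB x y : Omi (x - y) = Omi x - Omi y. Proof. exact: (linearB OmiL). Qed.
Let OmiZ c y : Omi (c *: y) = c *: Omi y. Proof. exact: (linearZ_LR OmiL). Qed.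

(** The factor exp(S a) is weakened to [M], so that one constant bounds the operator functions and
    their Taylor remainders. *)
Lemma norm_expop_le u x : `|u| <= S -> `|expop Om u x| <= M * `|x|.
Proof.
move=> uS; apply: le_trans (norm_expop a0 Oma _ _) _.
rewrite ler_wpM2r// ler_expR ler_wpM2r//; move: uS S1; lra.
Qed.

Lemma norm_half (x y : X) B : `|x| <= B -> `|y| <= B -> `|2^-1 *: (x + y)| <= B.
Proof.
move=> xB yB; rewrite normrZ ger0_norm ?invr_ge0// mulrC ler_pdivrMr//.
by apply: le_trans (ler_normD _ _) _; rewrite mulr_natr mulr2n lerD.
Qed.

Lemma norm_coshop u x : `|u| <= S -> `|coshop Om u x| <= M * `|x|.
Proof.
by move=> uS; apply: norm_half; apply: norm_expop_le => //; rewrite normrN.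
Qed.

Lemma norm_sinhop u x : `|u| <= S -> `|sinhop Om u x| <= M * `|x|.
Proof.
by move=> uS; apply: norm_half; rewrite ?normrN; apply: norm_expop_le => //; rewrite normrN.
Qed.

Lemma norm_Kop u x : `|u| <= S -> `|Kop u x| <= b * M * `|x|.
Proof.
move=> uS; apply: le_trans (Omib _) _; rewrite -mulrA ler_wpM2l//.
exact: norm_sinhop.
Qed.

Lemma coshop_linear u : linear (coshop Om u).
Proof.
move=> c x y; rewrite /coshop !(expop_linear a0 Oma).
rewrite addrACA -scalerDr [LHS]scalerDr; congr (_ + _).
by rewrite !scalerA mulrC.
Qed.

Lemma sinhop_linear u : linear (sinhop Om u).
Proof.
move=> c x y; rewrite /sinhop !(expop_linear a0 Oma) opprD addrACA -scalerBr.
by rewrite [LHS]scalerDr; congr (_ + _); rewrite !scalerA mulrC.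
Qed.

Lemma Kop_linear u : linear (Kop u).
Proof. by move=> c x y; rewrite /Kop sinhop_linear Omi_linear. Qed.

Lemma coshop0 x : coshop Om 0 x = x.
Proof.
rewrite /coshop oppr0 !(expop0 a0 Oma) -[x + x]mulr2n -[x *+ 2]scaler_nat scalerA.
by rewrite mulVf ?scale1r// pnatr_eq0.
Qed.

Lemma Kop0 x : Kop 0 x = 0.
Proof.
by rewrite -[Kop 0 x]/(OmiL (sinhop Om 0 x)) /sinhop oppr0 subrr scaler0 linear0.
Qed.

(** [Om] commutes with its exponentials. The right side is the derivative of cosh, so the two cancel
    to first order in the increments of [duhamel_delay]. *)
Lemma Kop_Om2 u x : Kop u (Om (Om x)) = Om (sinhop Om u x).
Proof.
have c y : sinhop Om u (Om y) = Om (sinhop Om u y).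
  by rewrite /sinhop !(expop_comm a0 Oma) -OmB -OmZ.
by rewrite /Kop !c OmK.
Qed.

Lemma coshop_taylor u h x : `|u| <= S -> `|u + h| <= S ->
  `|coshop Om (u + h) x - coshop Om u x - h *: Om (sinhop Om u x)|
    <= h ^+ 2 * (M * `|x|).
Proof.
move=> uS uhS.
have t1 := expop_taylor a0 Oma x S1 uS uhS.
have t2 : `|expop Om (- (u + h)) x - expop Om (- u) x - (- h) *: Om (expop Om (- u) x)|
    <= h ^+ 2 * (M * `|x|).
  by rewrite opprD -[h ^+ 2]sqrrN; apply: expop_taylor => //; rewrite -?opprD normrN.
suff -> : coshop Om (u + h) x - coshop Om u x - h *: Om (sinhop Om u x) =
  2^-1 *: ((expop Om (u + h) x - expop Om u x - h *: Om (expop Om u x)) +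
    (expop Om (- (u + h)) x - expop Om (- u) x - (- h) *: Om (expop Om (- u) x))).
  exact: norm_half.
rewrite /coshop /sinhop OmZ OmB scalerA [h * _]mulrC -scalerA -!scalerBr.
by congr (_ *: _); rewrite scaleNr scalerBr opprK regroup6.
Qed.

Lemma sinhop_taylor u h x : `|u| <= S -> `|u + h| <= S ->
  `|sinhop Om (u + h) x - sinhop Om u x - h *: Om (coshop Om u x)|
    <= h ^+ 2 * (M * `|x|).
Proof.
move=> uS uhS.
have t1 := expop_taylor a0 Oma x S1 uS uhS.
have t2 : `|- (expop Om (- (u + h)) x - expop Om (- u) x - (- h) *: Om (expop Om (- u) x))|
    <= h ^+ 2 * (M * `|x|).
  rewrite normrN opprD -[h ^+ 2]sqrrN; apply: expop_taylor => //.
    by rewrite normrN.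
  by rewrite -opprD normrN.
suff -> : sinhop Om (u + h) x - sinhop Om u x - h *: Om (coshop Om u x) =
  2^-1 *: ((expop Om (u + h) x - expop Om u x - h *: Om (expop Om u x)) -
    (expop Om (- (u + h)) x - expop Om (- u) x - (- h) *: Om (expop Om (- u) x))).
  exact: norm_half.
rewrite /coshop /sinhop OmZ OmD scalerA [h * _]mulrC -scalerA -!scalerBr.
congr (_ *: _); rewrite scaleNr scalerDr opprK.
rewrite -[in LHS](opprK (h *: Om (expop Om (- u) x))) regroup6.
by rewrite [in RHS]opprD [in RHS]opprB opprK [- _ + expop _ (- u) _]addrC.
Qed.

Lemma Kop_taylor u h x : `|u| <= S -> `|u + h| <= S ->
  `|Kop (u + h) x - Kop u x - h *: coshop Om u x| <= b * (h ^+ 2 * (M * `|x|)).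
Proof.
move=> uS uhS.
have -> : Kop (u + h) x - Kop u x - h *: coshop Om u x =
    Omi (sinhop Om (u + h) x - sinhop Om u x - h *: Om (coshop Om u x)).
  by rewrite !OmiB (OmiZ h (Om _)) OmK.
apply: le_trans (Omib _) _; rewrite ler_wpM2l//.
exact: sinhop_taylor.
Qed.

(** First-order Taylor, with one factor |v - u| of the quadratic remainder bounded by [2 * S]. It
    prices the freezing of the kernel. *)
Lemma Kop_lip u v x : `|u| <= S -> `|v| <= S ->
  `|Kop v x - Kop u x| <= (1 + 2 * S * b) * M * `|v - u| * `|x|.
Proof.
move=> uS vS; have E : u + (v - u) = v by rewrite addrC subrK.
have := @Kop_taylor u (v - u) x uS; rewrite E => /(_ vS) t.
rewrite -[Kop v x - _](subrK ((v - u) *: coshop Om u x)).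
apply: le_trans (ler_normD _ _) _.
apply: (@le_trans _ _ (b * (`|v - u| * (2 * S) * (M * `|x|)) + `|v - u| * (M * `|x|))).
  apply: lerD.
    apply: le_trans t _; rewrite ler_wpM2l// ler_wpM2r ?mulr_ge0 ?expR_ge0//.
    rewrite -real_normK ?num_real// expr2 ler_wpM2l//.
    by apply: le_trans (ler_normB _ _) _; rewrite mulr_natl mulr2n lerD.
  by rewrite normrZ ler_wpM2l//; exact: norm_coshop.
by rewrite le_eqVlt; apply/orP; left; apply/eqP; move: M => m; ring.
Qed.

End OperatorHyperbolic.

(** * Mean value inequalities *)

Section MeanValue.
Context {R : realType} {X : completeNormedModType R}.
Implicit Types (x : R -> X) (D : set R) (p q s e : R).

(** A supremum argument in the manner of Cousin's lemma. The local condition concerns only intervals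
    containing the tag [s], which is exactly what differentiability at one point provides. *)
Lemma mean_value_ineq (g : R -> X) (psi : R -> R) p q : p <= q ->
  (forall s e, p <= s <= q -> 0 < e -> exists2 d, 0 < d & forall u v,
     p <= u -> u <= s -> s <= v -> v <= q -> v - u < d ->
     `|g v - g u| <= psi v - psi u + e * (v - u)) ->
  `|g q - g p| <= psi q - psi p.
Proof.
move=> pq loc.
suff H e : 0 < e -> `|g q - g p| <= psi q - psi p + e * (q - p).
  apply/ler_addgt0Pr => e e0.
  (* The added 1 keeps the divisor positive when [p = q]. *)
  have c0 : 0 < q - p + 1 by lra.
  apply: le_trans (H (e / (q - p + 1)) _) _; first exact: divr_gt0.
  rewrite lerD2l mulrAC ler_pdivrMr// ler_wpM2l ?ltW//; lra.
move=> e0.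
pose S := [set r | p <= r <= q /\ `|g r - g p| <= psi r - psi p + e * (r - p)].
have Sp : S p by split; [rewrite lexx pq|rewrite !subrr normr0 mulr0 addr0].
have supS : has_sup S by split; [exists p|exists q => r [/andP[]]].
have ps : p <= sup S by apply: ub_le_sup => //; exact: supS.2.
have sq : sup S <= q by apply: ge_sup; [exists p|move=> r [/andP[]]].
have [d d0 hd] := loc (sup S) e (introT andP (conj ps sq)) e0.
(* Used twice: from a point just below the supremum, to put [sup S] into [S], and then from [sup S]
   itself, to pass beyond it. *)
have step r v : S r -> p <= r -> r <= sup S -> sup S <= v -> v <= q -> v - r < d -> S v.
  move=> [_ Sr] pr rs sv vq vd; split; first by rewrite vq andbT (le_trans ps sv).
  have h := hd r v pr rs sv vq vd.
  have := ler_normD (g v - g r) (g r - g p); rewrite addrA subrK => h2.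
  lra.
have Ss : S (sup S).
  have [r Sr rd] := sup_adherent d0 supS.
  have rs : r <= sup S by apply: ub_le_sup => //; exact: supS.2.
  by apply: (step r) => //; [case: Sr => /andP[]|lra].
have [<-|sltq] := eqVneq (sup S) q; first by case: Ss.
have {sltq sq}sq : sup S < q by rewrite lt_neqAle sltq.
pose v := Num.min q (sup S + d / 2).
have sv : sup S < v by rewrite /v lt_min sq /= ltrDl divr_gt0.
have vq : v <= q by rewrite /v ge_min lexx.
have vd : v - sup S < d.
  have : v <= sup S + d / 2 by rewrite /v ge_min lexx orbT.
  lra.
have Sv : S v by apply: (step (sup S)) => //; exact: ltW.
have : v <= sup S by apply: ub_le_sup => //; exact: supS.2.
by rewrite leNgt sv.
Qed.

Lemma C1on_diff D x x' s e : C1on D x x' -> D s -> 0 < e ->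
  exists2 d, 0 < d & forall v, D v -> `|v - s| < d ->
    `|x v - x s - (v - s) *: x' s| <= e * `|v - s|.
Proof.
move=> [_ dx] Ds e0.
have /cvgrPdist_lt /(_ e e0) := dx s Ds.
rewrite /within /= => -[d /= d0 H]; exists d => // v Dv vd.
have [->|vs] := eqVneq v s; first by rewrite !subrr scale0r subr0 !normr0 mulr0.
have vs0 : v - s != 0 by rewrite subr_eq0.
have E : s + (v - s) = v by rewrite addrC subrK.
have := H (v - s); rewrite /ball /= sub0r normrN => /(_ vd vs0).
rewrite /= E => /(_ Dv) /ltW h.
have -> : x v - x s - (v - s) *: x' s =
   - ((v - s) *: (x' s - (v - s)^-1 *: (x v - x s))).
  by rewrite scalerBr scalerA mulfV// scale1r opprB.
by rewrite normrN normrZ mulrC ler_wpM2r.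
Qed.

(** The errors on both sides of [s] are proportional to the two lengths, which add up to [v - u]
    because [s] lies between; so [e] is not enlarged. *)
Lemma C1on_straddle D x x' s e : C1on D x x' -> D s -> 0 < e ->
  exists2 d, 0 < d & forall u v, D u -> D v -> u <= s -> s <= v -> v - u < d ->
    `|x v - x u - (v - u) *: x' s| <= e * (v - u).
Proof.
move=> dx Ds e0; have [d d0 H] := C1on_diff dx Ds e0; exists d => // u v Du Dv us sv vu.
have hv := H v Dv; rewrite ger0_norm ?subr_ge0// in hv.
have hu := H u Du; rewrite distrC ger0_norm ?subr_ge0// in hu.
have {}hv : `|x v - x s - (v - s) *: x' s| <= e * (v - s) by apply: hv; lra.
have {}hu : `|x u - x s - (u - s) *: x' s| <= e * (s - u) by apply: hu; lra.
have -> : x v - x u - (v - u) *: x' s =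
  (x v - x s - (v - s) *: x' s) - (x u - x s - (u - s) *: x' s).
  have -> : (v - u) *: x' s = (v - s) *: x' s - (u - s) *: x' s.
    by rewrite -scalerBl; congr (_ *: _); ring.
  rewrite [in RHS]opprD [RHS]addrACA [in LHS]opprD; congr (_ + _).
  by rewrite opprB addrA subrK.
apply: le_trans (ler_normB _ _) _; lra.
Qed.

Lemma C1on_deriv_continuous D x x' s e : C1on D x x' -> D s -> 0 < e ->
  exists2 d, 0 < d & forall v, D v -> `|v - s| < d -> `|x' v - x' s| <= e.
Proof.
move=> [cx _] Ds e0.
have /subspace_continuousP /(_ s Ds) /cvgrPdist_lt /(_ e e0) := cx.
rewrite /within /= => -[d /= d0 H]; exists d => // v Dv vd.
by rewrite distrC ltW// H//= distrC.
Qed.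

Lemma C1on_subset D D' x x' : D' `<=` D -> C1on D x x' -> C1on D' x x'.
Proof.
move=> DD [cx dx]; split; first exact: continuous_subspaceW DD cx.
move=> t D't; apply: cvg_trans (dx t (DD _ D't)).
apply: cvg_app; apply: within_subset; exact: (fun h H => DD _ H).
Qed.

Lemma C1on_mvt D x x' p q B : C1on D x x' -> p <= q ->
  (forall s, p <= s <= q -> D s) -> (forall s, p <= s <= q -> `|x' s| <= B) ->
  `|x q - x p| <= B * (q - p).
Proof.
move=> dx pq DD xB.
have -> : B * (q - p) = B * q - B * p by ring.
apply: mean_value_ineq => // s e psq e0.
have [d d0 H] := C1on_straddle dx (DD s psq) e0; exists d => // u v pu us sv vq vu.
have /andP[ps sq] := psq.
have Du : D u by apply: DD; rewrite pu (le_trans us sq).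
have Dv : D v by apply: DD; rewrite vq (le_trans ps sv).
have h := H u v Du Dv us sv vu.
have := ler_normD (x v - x u - (v - u) *: x' s) ((v - u) *: x' s); rewrite subrK.
rewrite normrZ ger0_norm ?subr_ge0 ?(le_trans us sv)// => h2.
have h3 : (v - u) * `|x' s| <= (v - u) * B.
  by rewrite ler_wpM2l ?subr_ge0 ?(le_trans us sv)// xB.
lra.
Qed.

Lemma C1on_deriv_bounded D x x' p q : C1on D x x' -> p <= q ->
  (forall s, p <= s <= q -> D s) -> exists B, forall s, p <= s <= q -> `|x' s| <= B.
Proof.
move=> [cx _] pq DD.
have c : {within `[p, q], continuous (fun s => `|x' s|)}.
  apply/subspace_continuousP => s /=; rewrite in_itv /= => psq.
  apply: cvg_norm.
  have sub : `[p, q] `<=` D by move=> r /=; rewrite in_itv /=; exact: DD.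
  have /subspace_continuousP := continuous_subspaceW sub cx.
  by apply; rewrite /= in_itv.
have [c0 _ hc] := EVT_max pq c.
by exists `|x' c0| => s psq; apply: hc; rewrite in_itv.
Qed.

Lemma C1on_bounded D x x' p q : C1on D x x' -> p <= q ->
  (forall s, p <= s <= q -> D s) -> exists B, forall s, p <= s <= q -> `|x s| <= B.
Proof.
move=> dx pq DD; have [B hB] := C1on_deriv_bounded dx pq DD.
have B0 : 0 <= B by apply: le_trans (hB p _); rewrite ?lexx.
exists (`|x p| + B * (q - p)) => s /andP[ps sq].
have h : `|x s - x p| <= B * (s - p).
  apply: (C1on_mvt dx ps) => r /andP[pr rs]; [apply: DD|apply: hB];
  by rewrite pr (le_trans rs sq).
have := ler_normD (x p) (x s - x p); rewrite addrC subrK => h2.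
have h3 : B * (s - p) <= B * (q - p) by rewrite ler_wpM2l// lerD2r.
lra.
Qed.

(** The interval is nondegenerate, so from any [s] one can move by [d <= (q - p) / 2] inward, right
    from the left half and left from the right half, and compare the two difference quotients
    there. *)
Lemma C1on_deriv_unique p q x x' y y' s : p < q -> p <= s <= q ->
  C1on `[p, q] x x' -> C1on `[p, q] y y' ->
  (forall t, p <= t <= q -> x t = y t) -> x' s = y' s.
Proof.
move=> pq psq dx dy xy.
have Ds : `[p, q]%classic s by rewrite /= in_itv.
apply/eqP; rewrite -subr_eq0 -normr_le0; apply/ler_addgt0Pr => e e0; rewrite add0r.
have e20 : 0 < e / 2 by lra.
have [d1 d10 H1] := C1on_diff dx Ds e20; have [d2 d20 H2] := C1on_diff dy Ds e20.
have /andP[ps sq] := psq.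
pose d := Num.min (Num.min d1 d2) (q - p) / 2.
have d0 : 0 < d by rewrite divr_gt0// !lt_min d10 d20 subr_gt0.
have dd1 : d < d1.
  have : Num.min (Num.min d1 d2) (q - p) <= d1 by rewrite !ge_min lexx.
  by rewrite /d in d0 *; lra.
have dd2 : d < d2.
  have : Num.min (Num.min d1 d2) (q - p) <= d2 by rewrite !ge_min lexx orbT.
  by rewrite /d in d0 *; lra.
have dqp : d <= (q - p) / 2.
  have : Num.min (Num.min d1 d2) (q - p) <= q - p by rewrite ge_min lexx orbT.
  by rewrite /d; lra.
have [v [Dv vs]] : exists v, p <= v <= q /\ `|v - s| = d.
  have [h|h] := lerP s ((p + q) / 2).
    exists (s + d); rewrite [s + d]addrC addrK gtr0_norm//; split => //.
    by apply/andP; split; lra.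
  exists (s - d); rewrite addrAC subrr add0r normrN gtr0_norm//; split => //.
  by apply/andP; split; lra.
have Dv' : `[p, q]%classic v by rewrite /= in_itv.
have := H1 v Dv'; rewrite vs => /(_ dd1) h1.
have := H2 v Dv'; rewrite vs => /(_ dd2); rewrite -!xy// => h2.
have := ler_normB (x v - x s - (v - s) *: y' s) (x v - x s - (v - s) *: x' s).
rewrite opprB addrC addrA subrK -scalerBr normrZ vs => h3.
have h4 : d * `|x' s - y' s| <= d * e by lra.
by move: h4; rewrite ler_pM2l.
Qed.

(** Boundedness must be supplied, as [sup] of an unbounded set is the default value 0. *)
Lemma le_supnorm p q (g : R -> X) t : (exists B, forall s, p <= s <= q -> `|g s| <= B) ->
  p <= t <= q -> `|g t| <= supnorm p q g.
Proof.
move=> [B hB] ptq; apply: ub_le_sup.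
  by exists B => z [s /=]; rewrite in_itv /= => /hB h <-.
by exists t => //=; rewrite in_itv.
Qed.

End MeanValue.

(** * The delay equation *)

Section DelayGrowth.
Context {R : realType} {X : completeNormedModType R}.

(** With y = l(s - u), z = l(v - s) and y + z <= 1: exp(z) >= 1 + z and exp(-y) <= 1/(1 + y) <= 1 -
    y/2, so the difference is at least (y + z)/2. *)
Lemma expR_straddle (l u s v : R) : 0 < l -> u <= s -> s <= v -> l * (v - u) <= 1 ->
  l * (v - u) * expR (l * s) <= 2 * (expR (l * v) - expR (l * u)).
Proof.
move=> l0 us sv lvu; set E := expR (l * s); have E0 : 0 < E by exact: expR_gt0.
have y0 : 0 <= l * (s - u) by rewrite mulr_ge0 ?(ltW l0)// subr_ge0.
have z0 : 0 <= l * (v - s) by rewrite mulr_ge0 ?(ltW l0)// subr_ge0.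
have yz : l * (v - u) = l * (v - s) + l * (s - u) by ring.
have hv : E * (1 + l * (v - s)) <= expR (l * v).
  have -> : l * v = l * s + l * (v - s) by ring.
  by rewrite expRD ler_pM2l// expR_ge1Dx.
have hu : expR (l * u) <= E * (1 - l * (s - u) / 2).
  have h : expR (l * u) * (1 + l * (s - u)) <= E.
    have -> : E = expR (l * u) * expR (l * (s - u)).
      by rewrite -expRD; congr expR; ring.
    by rewrite ler_pM2l ?expR_gt0// expR_ge1Dx.
  have p0 : 0 < 1 + l * (s - u) by lra.
  rewrite -(ler_pM2r p0); apply: le_trans h _.
  have : E * 1 <= E * ((1 - l * (s - u) / 2) * (1 + l * (s - u))).
    rewrite ler_pM2l//.
    move: (l * (s - u)) y0 (l * (v - s)) z0 (l * (v - u)) lvu yz => y y0 z z0 w lvu yz.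
    by nra.
  by rewrite mulr1 mulrA.
have : 0 <= E * (l * (v - s)) by rewrite mulr_ge0 ?(ltW E0).
move: hu hv; rewrite yz; move: (expR (l * u)) (expR (l * v)) => eu ev.
by lra.
Qed.

(** With A = a^2 T this is the final value of c0 + A M exp(l T) in [delay_growth], using c0 <= (1 +
    A)(N + Q) and M <= 2 (1 + (1 + A) T)(N + Q), with N + Q factored out. *)
Definition growth_cst (T a : R) : R :=
  (1 + a ^+ 2 * T) + 2 * (a ^+ 2 * T) * (1 + (1 + a ^+ 2 * T) * T)
    * expR ((4 * (a ^+ 2 * T) + 1) * T).

Lemma growth_cst_ge0 T a : 0 <= T -> 0 <= growth_cst T a.
Proof.
move=> T0; have A0 : 0 <= a ^+ 2 * T by rewrite mulr_ge0 ?sqr_ge0.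
rewrite /growth_cst; apply: addr_ge0; first exact: addr_ge0.
apply: mulr_ge0; last exact: expR_ge0.
apply: mulr_ge0; first exact: mulr_ge0.
by apply: addr_ge0 => //; apply: mulr_ge0 => //; exact: addr_ge0.
Qed.

(** [M] is the supremum of exp(-l s)|x(s)| on [0, T]. The equation bounds x' in terms of [M], and
    integrating returns at most M/2 for large [l], which is absorbed. *)
Lemma delay_growth (Om : {linear X -> X}) (T tau a N Q : R) (x x' : R -> X) :
  0 < T -> 0 < tau -> 0 <= a -> 0 <= N -> 0 <= Q ->
  (forall y, `|Om y| <= a * `|y|) ->
  C1on `[- (2 * tau), +oo[ x x' ->
  (forall s, - (2 * tau) <= s <= 0 -> `|x s| <= N) ->
  (forall s, - (2 * tau) <= s <= 0 -> `|x' s| <= N) ->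
  (forall t, 0 <= t <= T -> exists v w,
     [/\ bochner (fun s => x (s - 2 * tau)) `[0, t] v, `|w| <= Q
       & x' t = x' 0 + Om (Om v) + w]) ->
  forall t, - (2 * tau) <= t <= T -> `|x' t| <= growth_cst T a * (N + Q).
Proof.
move=> T0 tau0 a0 N0 Q0 Oma dx xN x'N sol.
have aT0 : 0 <= a ^+ 2 * T by rewrite mulr_ge0 ?sqr_ge0// ltW.
set A := a ^+ 2 * T in aT0.
(* Chosen so that 2A/l <= 1/2, the 2 being the loss in [expR_straddle]; the 1 keeps [l] positive
   when [A] vanishes. *)
pose l := 4 * A + 1; have l0 : 0 < l by rewrite /l; lra.
have DD p : - (2 * tau) <= p -> `[- (2 * tau), +oo[%classic p.
  by move=> h; rewrite /= in_itv /= h.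
have DD0 s : 0 <= s -> `[- (2 * tau), +oo[%classic s by move=> h; apply: DD; lra.
pose Z := [set expR (- (l * s)) * `|x s| | s in `[0, T]].
have [B hB] : exists B, forall s, 0 <= s <= T -> `|x s| <= B.
  by apply: (C1on_bounded dx (ltW T0)) => s /andP[/DD0].
have ubZ : has_ubound Z.
  exists B => z [s /=]; rewrite in_itv /= => sT <-.
  apply: le_trans (hB s sT); rewrite ler_piMl// -expR0 ler_expR oppr_le0.
  by rewrite mulr_ge0 ?(ltW l0)//; case/andP: sT.
set M := sup Z.
have hM s : 0 <= s <= T -> `|x s| <= M * expR (l * s).
  move=> sT; have : expR (- (l * s)) * `|x s| <= M.
    by apply: ub_le_sup => //; exists s => //=; rewrite in_itv.
  by rewrite expRN mulrC ler_pdivrMr ?expR_gt0.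
have M0 : 0 <= M.
  apply: le_trans (_ : expR (- (l * 0)) * `|x 0| <= _); first by rewrite mulr_ge0 ?expR_ge0.
  by apply: ub_le_sup => //; exists 0 => //=; rewrite in_itv /= lexx ltW.
have Ole t s : s <= t -> expR (l * s) <= expR (l * t).
  by move=> st; rewrite ler_expR ler_pM2l.
pose c0 := N + A * N + Q.
have hx' t : 0 <= t <= T -> `|x' t| <= c0 + A * M * expR (l * t).
  move=> tT; have [v [w [bv wQ ->]]] := sol t tT; have /andP[t0 tT'] := tT.
  have hv : `|v| <= (N + M * expR (l * t)) * t.
    apply: (bochner_norm_cst t0 bv) => r /andP[r0 rt].
    have Me0 : 0 <= M * expR (l * t) by rewrite mulr_ge0 ?expR_ge0.
    have [h|h] := lerP r (2 * tau).
      have h1 : `|x (r - 2 * tau)| <= N by apply: xN; apply/andP; split; lra.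
      lra.
    have h1 : `|x (r - 2 * tau)| <= M * expR (l * (r - 2 * tau)).
      by apply: hM; apply/andP; split; lra.
    apply: le_trans h1 _.
    have h2 : M * expR (l * (r - 2 * tau)) <= M * expR (l * t).
      by rewrite ler_wpM2l// Ole//; lra.
    lra.
  have hv2 : `|Om (Om v)| <= A * (N + M * expR (l * t)).
    apply: le_trans (Oma _) _; apply: le_trans (ler_wpM2l a0 (Oma _)) _.
    rewrite /A mulrA -expr2 -mulrA ler_wpM2l ?sqr_ge0//.
    apply: le_trans hv _; rewrite mulrC ler_wpM2r//.
    by rewrite addr_ge0// mulr_ge0 ?expR_ge0.
  have h0 : `|x' 0| <= N by apply: x'N; rewrite lexx andbT; lra.
  have n1 := ler_normD (x' 0 + Om (Om v)) w.
  have n2 := ler_normD (x' 0) (Om (Om v)).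
  rewrite /c0; lra.
have hx t : 0 <= t <= T -> `|x t| <= N + c0 * T + M / 2 * expR (l * t).
  move=> /andP[t0 tT].
  (* The exponential part is twice the primitive of A M exp(l r), to pay for evaluating it at an
     arbitrary tag. *)
  pose psi r := c0 * r + 2 * (A * M) / l * expR (l * r).
  have : `|x t - x 0| <= psi t - psi 0.
    apply: mean_value_ineq => // s e /andP[s0 st] e0.
    have [d d0 H] := C1on_straddle dx (DD0 s s0) e0.
    exists (Num.min d l^-1); first by rewrite lt_min d0 invr_gt0.
    move=> u v u0 us sv vt; rewrite lt_min => /andP[vud vul].
    have uv := le_trans us sv; have v0 := le_trans u0 uv.
    have lvu : l * (v - u) <= 1 by rewrite mulrC -ler_pdivlMr// mul1r ltW.
    have h := H u v (DD0 u u0) (DD0 v v0) us sv vud.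
    have hs : `|x' s| <= c0 + A * M * expR (l * s).
      by apply: hx'; rewrite s0 (le_trans st).
    have n := ler_normD (x v - x u - (v - u) *: x' s) ((v - u) *: x' s).
    rewrite subrK normrZ ger0_norm ?subr_ge0// in n.
    have hs2 : (v - u) * `|x' s| <= (v - u) * (c0 + A * M * expR (l * s)).
      by rewrite ler_wpM2l// subr_ge0.
    have es := expR_straddle l0 us sv lvu.
    have es2 : (v - u) * (A * M * expR (l * s)) <=
       2 * (A * M) / l * (expR (l * v) - expR (l * u)).
      have -> : 2 * (A * M) / l * (expR (l * v) - expR (l * u)) =
        (A * M) * (2 * (expR (l * v) - expR (l * u))) / l by ring.
      rewrite ler_pdivlMr//.
      apply: le_trans (ler_wpM2l (mulr_ge0 aT0 M0) es).
      by rewrite le_eqVlt; apply/orP; left; apply/eqP; ring.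
    rewrite /psi; lra.
  have h0 : `|x 0| <= N by apply: xN; rewrite lexx andbT; lra.
  have n := ler_normD (x t - x 0) (x 0); rewrite subrK in n.
  have k1 : 2 * (A * M) / l <= M / 2.
    rewrite ler_pdivrMr// /l; move: (mulr_ge0 aT0 M0); lra.
  have k0 : 0 <= 2 * (A * M) / l by rewrite divr_ge0 ?mulr_ge0// ltW.
  have k2 : 2 * (A * M) / l * expR (l * t) <= M / 2 * expR (l * t).
    by rewrite ler_wpM2r ?expR_ge0.
  have k3 : 0 <= 2 * (A * M) / l * expR (l * 0) by rewrite mulr_ge0 ?expR_ge0.
  have k4 : c0 * t <= c0 * T.
    by rewrite ler_wpM2l// /c0 !addr_ge0// mulr_ge0.
  by rewrite /psi => hh; lra.
pose P := N + c0 * T.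
have c00 : 0 <= c0 by rewrite /c0 !addr_ge0// mulr_ge0.
have P0 : 0 <= P by rewrite /P addr_ge0// mulr_ge0// ltW.
have MP : M <= 2 * P.
  suff : M <= P + M / 2 by lra.
  apply: ge_sup; first by exists (expR (- (l * 0)) * `|x 0|), 0 => //=; rewrite in_itv /= lexx ltW.
  move=> z [s /=]; rewrite in_itv /= => sT <-.
  rewrite expRN mulrC ler_pdivrMr ?expR_gt0//.
  have h1 : P * 1 <= P * expR (l * s).
    rewrite ler_wpM2l// -expR0 ler_expR mulr_ge0 ?(ltW l0)//.
    by case/andP: sT.
  have := hx s sT; rewrite -/P => h2; lra.
have c0le : c0 <= (1 + A) * (N + Q).
  by rewrite /c0; have := mulr_ge0 aT0 Q0; lra.
have Ple : P <= (1 + (1 + A) * T) * (N + Q).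
  have : c0 * T <= (1 + A) * (N + Q) * T by rewrite ler_wpM2r// ltW.
  rewrite /P; lra.
have G0 : 0 <= 2 * A * (1 + (1 + A) * T) * expR (l * T).
  have h1 : 0 <= (1 + A) * T by rewrite mulr_ge0 ?addr_ge0// ltW.
  apply: mulr_ge0; last exact: expR_ge0.
  by apply: mulr_ge0; [exact: mulr_ge0|lra].
rewrite /growth_cst -/A -/l => t /andP[t1 tT].
have [t0|t0] := lerP t 0.
  apply: le_trans (x'N t _) _; first by rewrite t1.
  have : 0 <= A * (N + Q) by rewrite mulr_ge0// addr_ge0.
  have : 0 <= 2 * A * (1 + (1 + A) * T) * expR (l * T) * (N + Q).
    by rewrite mulr_ge0// addr_ge0.
  rewrite mulrDl; lra.
have tT' : 0 <= t <= T by rewrite ltW.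
apply: le_trans (hx' t tT') _; rewrite [leRHS]mulrDl; apply: lerD => //.
have -> : 2 * A * (1 + (1 + A) * T) * expR (l * T) * (N + Q) =
  A * (2 * ((1 + (1 + A) * T) * (N + Q))) * expR (l * T) by ring.
apply: ler_pM; [exact: mulr_ge0|exact: expR_ge0| |exact: Ole].
rewrite ler_wpM2l//; lra.
Qed.

End DelayGrowth.

(** The index 1 stands for operator and state both at [v], 2 for the operator frozen at [u] with the
    state at [v], 3 for both at [u]. The first-order terms [al] and [be] are inserted so that each
    bracket is small; [ga] and [de] are the delay and forcing parts of the increment of x'. *)
Lemma regroup_increment (V : zmodType) (c1 c2 c3 k1 k2 k3 al be ga de i1 i2 : V) :
  k2 - k3 = ga + de ->
  (c1 + k1 - i1) - (c3 + k3 - i2) =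
  ((c1 - c2 + al) + (c2 - c3 - be)) + ((k1 - k2 + be) + (ga - al)) + (de - (i1 - i2)).
Proof.
move=> k23.
have -> : (c1 + k1 - i1) - (c3 + k3 - i2) = (c1 - c3) + (k1 - k3) - (i1 - i2).
  by rewrite !opprD addrACA [c1 + k1 + _]addrACA.
have -> : k1 - k3 = (k1 - k2) + (ga + de) by rewrite -k23 addrA subrK.
rewrite [c1 - c2 + al + _]addrACA [k1 - k2 + be + _]addrACA [X in X + (de - _)]addrACA.
rewrite [al - be + _]addrA subrK subrr addr0 [c1 - c2 + _]addrA subrK.
by rewrite !addrA.
Qed.

(** * The defect in the Duhamel formula caused by the delay *)

Section DelayEstimate.
Context {R : realType} {X : completeNormedModType R}.
Variables (Om : {linear X -> X}) (Omi : X -> X) (a b T : R).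
Hypotheses (OmK : cancel Om Omi) (OmiK : cancel Omi Om).
Hypotheses (a0 : 0 <= a) (Oma : forall y, `|Om y| <= a * `|y|).
Hypotheses (b0 : 0 <= b) (Omib : forall y, `|Omi y| <= b * `|y|).

Local Notation M := (expR (2 * (T + 1) * a)).
Local Notation K := (Kop Om Omi).

Lemma sfun_int_itv0 (sg : seq (set R * X)) : smeas sg -> sfun_int `[0, 0] sg = 0.
Proof.
elim: sg => [_|p sg IH /= [mp /IH h]]; first by rewrite /sfun_int big_nil.
rewrite sfun_int_cons h addr0.
suff -> : completed_lebesgue_measure (p.1 `&` `[0, 0]) = 0%E by rewrite scale0r.
apply/eqP; rewrite eq_le lmu_ge0 andbT.
have m0 := Lmeasurable_itv `[(0 : R), 0].
by apply: le_trans (le_lmu (LmeasurableI mp m0) m0 _) _ => //; rewrite lmu_itvcc// subrr.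
Qed.

(** The pointwise defect K Om^2 (x(s - 2 tau) - x(s)) is at most b M a^2 2 tau B, as [B] makes [x]
    Lipschitz on the history and on [0, T] alike. *)
Lemma duhamel_delay (f : R -> X) (tau t B : R) (x x' : R -> X) (vg : X) :
  0 < tau -> 0 <= t <= T -> 0 <= B ->
  C1on `[- (2 * tau), +oo[ x x' ->
  (forall s, - (2 * tau) <= s <= T -> `|x' s| <= B) ->
  (forall s, 0 <= s -> exists v w,
     [/\ bochner (fun s => x (s - 2 * tau)) `[0, s] v, bochner f `[0, s] w
       & x' s = x' 0 + Om (Om v) + w]) ->
  bochner (fun s => K (t - s) (f s)) `[0, t] vg ->
  `|x t - coshop Om t (x 0) - K t (x' 0) - vg| <= b * M * (a ^+ 2 * (2 * tau * B)) * t.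
Proof.
move=> tau0 tT B0 dx x'B sol gv; have /andP[t0 tT'] := tT.
have S1 : 1 <= T + 1 by lra.
have M0 : 0 < M by exact: expR_gt0.
pose L := b * M * (a ^+ 2 * (2 * tau * B)).
pose cK := (1 + 2 * (T + 1) * b) * M.
have cK0 : 0 <= cK by rewrite mulr_ge0 ?(ltW M0)// addr_ge0// !mulr_ge0//; lra.
have DD s : - (2 * tau) <= s -> `[- (2 * tau), +oo[%classic s.
  by move=> h; rewrite /= in_itv /= h.
have DD0 s : 0 <= s -> `[- (2 * tau), +oo[%classic s by move=> h; apply: DD; lra.
have nS u : 0 <= u -> u <= t -> `|t - u| <= T + 1.
  by move=> u0 ut; rewrite ger0_norm; lra.
have lip r s : - (2 * tau) <= r -> r <= s -> s <= T -> `|x s - x r| <= B * (s - r).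
  move=> r0 rs sT; apply: (C1on_mvt dx rs) => q /andP[rq qs].
    by apply: DD; exact: le_trans rq.
  by apply: x'B; rewrite (le_trans r0 rq) (le_trans qs sT).
have [Bx hBx] : exists Bx, forall s, 0 <= s <= t -> `|x s| <= Bx.
  by apply: (C1on_bounded dx t0) => s /andP[/DD0].
have Bx0 : 0 <= Bx by apply: le_trans (hBx 0 _); rewrite ?lexx.
have [s0 [ok [_ [cv1 _]]]] := gv.
have ms n : smeas (s0 n) by have := ok n; exact: sfun_ok_smeas.
have mt := Lmeasurable_itv `[0, t]; have ft := lmu_itv0_lty t0.
pose m s := rint s (fun r => `|f r|).
have m0 s : 0 <= m s by exact: rint_ge0.
(* The mesh width [eta] and the index [n] of the simple approximation stay fixed through the mean
   value argument and are chosen only afterwards. *)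
have key eta n : 0 < eta ->
    `|(x t - sfun_int `[0, t] (s0 n)) - (coshop Om t (x 0) + K t (x' 0))|
      <= L * t + cK * eta * m t
         + rint t (fun r => `|K (t - r) (f r) - sfun_eval (s0 n) r|).
  move=> eta0; pose e s := rint s (fun r => `|K (t - r) (f r) - sfun_eval (s0 n) r|).
  rewrite -/(e t).
  have e0 s : 0 <= e s by exact: rint_ge0.
  (* The integral of [s0 n] stands in for the primitive of K(t - r) f(r), of which only the value
     over the whole of [0, t] is supplied. *)
  pose Phi s := coshop Om (t - s) (x s) + K (t - s) (x' s) - sfun_int `[0, s] (s0 n).
  pose psi s := L * s + (cK * eta * m s + e s).
  have : `|Phi t - Phi 0| <= psi t - psi 0.
    apply: mean_value_ineq => // s ep /andP[s0' st] ep0.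
    have e40 : 0 < ep / (4 * M) by rewrite divr_gt0// mulr_gt0.
    (* The total coefficient of the quadratic remainders in [n1], [n4] and [n5]. *)
    pose W := b * M * (a ^+ 2 * B) + M * Bx + b * (M * B).
    have W0 : 0 <= W.
      by rewrite /W !addr_ge0 ?mulr_ge0 ?sqr_ge0 ?(ltW M0).
    have W1 : 0 < 2 * (W + 1) by lra.
    have [d1 d10 H1] := C1on_straddle dx (DD0 s s0') e40.
    have [d2 d20 H2] := C1on_deriv_continuous dx (DD0 s s0') e40.
    (* [d1] and [d2] keep the error in [n2] below half of [ep * h], the last entry does so for the
       quadratic remainders, and [eta] limits the variation of the kernel in [n3]. *)
    exists (Num.min (Num.min d1 d2) (Num.min eta (ep / (2 * (W + 1))))).
      by rewrite !lt_min d10 d20 eta0 divr_gt0.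
    move=> u v u0 us sv vt; rewrite !lt_min => /andP[/andP[vu1 vu2] /andP[vu3 vu4]].
    have uv := le_trans us sv; have v0 := le_trans u0 uv; have ut := le_trans uv vt.
    have uv' : 0 <= u <= v by rewrite u0.
    pose h := v - u; have h0 : 0 <= h by rewrite subr_ge0.
    have [Vu [wu [bVu bwu xu]]] := sol u u0.
    have [Vv [wv [bVv bwv xv]]] := sol v v0.
    have pS := nS u u0 ut; have vS := nS v v0 vt.
    have tv : t - v = (t - u) + (- h) by rewrite /h; ring.
    have x'v : `|x' v| <= B.
      by apply: x'B; rewrite (le_trans vt tT') (le_trans _ v0)// oppr_le0 mulr_ge0// ltW.
    have xvB : `|x v| <= Bx by apply: hBx; rewrite v0.
    pose KL : {linear X -> X} := HB.pack (K (t - u))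
      (GRing.isLinear.Build R X X *:%R (K (t - u)) (Kop_linear OmK OmiK a0 Oma (t - u))).
    have KB y : `|KL y| <= b * M * `|y| by exact: norm_Kop.
    have bM0 : 0 <= b * M by rewrite mulr_ge0// ltW.
    pose CL : {linear X -> X} := HB.pack (coshop Om (t - u))
      (GRing.isLinear.Build R X X *:%R (coshop Om (t - u)) (coshop_linear a0 Oma (t - u))).
    have OmB y z : Om (y - z) = Om y - Om z by exact: linearB.
    have OmZ c y : Om (c *: y) = c *: Om y by exact: linearZ.
    have KLB y z : KL (y - z) = KL y - KL z by exact: linearB.
    have KLZ c y : KL (c *: y) = c *: KL y by exact: linearZ_LR.
    have CLB y z : CL (y - z) = CL y - CL z by exact: linearB.
    have CLZ c y : CL (c *: y) = c *: CL y by exact: linearZ_LR.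
    (* The delay error enters here: x(r - 2 tau) differs from x(v) by at most (2 tau + h) B for r in
       (u, v]. *)
    have n1 : `|KL (Om (Om (Vv - Vu))) - h *: Om (sinhop Om (t - u) (x v))|
        <= b * M * (a * (a * ((2 * tau + h) * B * h))).
      rewrite -(Kop_Om2 OmK a0 Oma) -[K _ _]/(KL _).
      have <- : KL (Om (Om (Vv - Vu - h *: x v))) =
          KL (Om (Om (Vv - Vu))) - h *: KL (Om (Om (x v))).
        by rewrite (OmB (Vv - Vu)) OmZ (OmB (Om (Vv - Vu))) OmZ KLB KLZ.
      apply: le_trans (KB _) _; rewrite ler_wpM2l//.
      apply: le_trans (Oma _) _; rewrite ler_wpM2l//.
      apply: le_trans (Oma _) _; rewrite ler_wpM2l//.
      apply: (bochner_incr_cst uv' bVu bVv) => r /andP[ur rv].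
      rewrite distrC; apply: le_trans (lip _ _ _ _ _) _.
      - by rewrite -[leLHS]add0r lerD2r (le_trans u0 (ltW ur)).
      - by rewrite lerBlDr (le_trans rv)// lerDl mulr_ge0// ltW.
      - exact: le_trans vt tT'.
      - by rewrite [leRHS]mulrC ler_wpM2l// opprB addrCA lerD2l lerD2l lerN2 ltW.
    have n2 : `|CL (x v) - CL (x u) - h *: CL (x' v)| <= M * (ep / (4 * M) * h + ep / (4 * M) * h).
      have -> : CL (x v) - CL (x u) - h *: CL (x' v) = CL (x v - x u - h *: x' v).
        by rewrite (CLB (x v - x u)) CLB CLZ.
      apply: le_trans (norm_coshop a0 Oma S1 _ pS) _; rewrite ler_pM2l//.
      have -> : x v - x u - h *: x' v =
         (x v - x u - h *: x' s) - h *: (x' v - x' s).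
        by rewrite scalerBr opprB addrA subrK.
      apply: le_trans (ler_normB _ _) _; apply: lerD.
        by apply: H1 => //; exact: DD0.
      rewrite normrZ ger0_norm// mulrC ler_wpM2r//; apply: H2; first exact: DD0.
      by rewrite ger0_norm ?subr_ge0//; apply: le_lt_trans vu2; rewrite lerD2l lerN2.
    have n3 := @bochner_incr_kernel R X u v t KL (b * M) (cK * eta) f
      (fun r => K (t - r) (f r)) wu wv vg (s0 n) uv' vt bM0 KB
      (mulr_ge0 cK0 (ltW eta0)) bwu bwv gv (ms n).
    have {}n3 : `|KL (wv - wu) - (sfun_int `[0, v] (s0 n) - sfun_int `[0, u] (s0 n))| <=
        cK * eta * (m v - m u) + (e v - e u).
      apply: n3 => r /andP[ur rv].
      have rS := nS r (le_trans u0 (ltW ur)) (le_trans rv vt).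
      apply: le_trans (Kop_lip OmK OmiK a0 Oma b0 Omib S1 _ rS pS) _.
      rewrite ler_wpM2r// ler_wpM2l//.
      rewrite opprB addrC addrA subrK ger0_norm ?subr_ge0 ?(ltW ur)//.
      by apply: ltW; apply: le_lt_trans vu3; rewrite lerD2r.
    have n4 : `|coshop Om (t - v) (x v) - CL (x v) + h *: Om (sinhop Om (t - u) (x v))|
        <= h ^+ 2 * (M * Bx).
      have := @coshop_taylor _ _ Om a (T + 1) a0 Oma S1 (t - u) (- h) (x v) pS.
      rewrite -tv sqrrN scaleNr opprK => /(_ vS) hh; apply: le_trans hh _.
      by rewrite ler_wpM2l ?sqr_ge0// ler_pM2l.
    have n5 : `|K (t - v) (x' v) - KL (x' v) + h *: CL (x' v)|
        <= b * (h ^+ 2 * (M * B)).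
      have := @Kop_taylor _ _ Om Omi a b (T + 1) OmK OmiK a0 Oma b0 Omib S1
        (t - u) (- h) (x' v) pS.
      rewrite -tv sqrrN scaleNr opprK => /(_ vS) hh; apply: le_trans hh _.
      by rewrite ler_wpM2l// ler_wpM2l ?sqr_ge0// ler_pM2l.
    (* The increment of x' is read off the integrated equation. *)
    have k23 : KL (x' v) - KL (x' u) = KL (Om (Om (Vv - Vu))) + KL (wv - wu).
      rewrite -raddfB -raddfD xu xv; congr (KL _).
      rewrite !OmB [in LHS]opprD [LHS]addrACA; congr (_ + _).
      by rewrite opprD addrACA subrr add0r.
    have -> : Phi v - Phi u =
      ((coshop Om (t - v) (x v) - CL (x v) + h *: Om (sinhop Om (t - u) (x v)))
       + (CL (x v) - CL (x u) - h *: CL (x' v)))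
      + ((K (t - v) (x' v) - KL (x' v) + h *: CL (x' v))
       + (KL (Om (Om (Vv - Vu))) - h *: Om (sinhop Om (t - u) (x v))))
      + (KL (wv - wu) - (sfun_int `[0, v] (s0 n) - sfun_int `[0, u] (s0 n))).
      exact: regroup_increment.
    have tri (y1 y2 y3 y4 y5 : X) :
       `|(y1 + y2) + (y3 + y4) + y5| <= `|y1| + `|y2| + (`|y3| + `|y4|) + `|y5|.
      apply: le_trans (ler_normD _ _) _; rewrite lerD2r.
      apply: le_trans (ler_normD _ _) _; apply: lerD; exact: ler_normD.
    apply: le_trans (tri _ _ _ _ _) _.
    have hW : h * (h * W) <= h * (ep / 2).
      rewrite ler_wpM2l//.
      move: vu4; rewrite -/h ltr_pdivlMr// => vu4.
      have := mulr_ge0 h0 W0; lra.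
    have e4M : M * (ep / (4 * M) * h + ep / (4 * M) * h) = h * (ep / 2).
      by field; rewrite gt_eqF.
    rewrite e4M in n2.
    have Wd : h * (h * W) = h ^+ 2 * (b * M * (a ^+ 2 * B)) + h ^+ 2 * (M * Bx)
       + b * (h ^+ 2 * (M * B)) by rewrite /W; ring.
    (* The part linear in h is kept in [psi] as [L]; the rest is quadratic and belongs to [W]. *)
    have Ld : b * M * (a * (a * ((2 * tau + h) * B * h))) =
       L * h + h ^+ 2 * (b * M * (a ^+ 2 * B)) by rewrite /L; ring.
    rewrite Ld in n1; rewrite Wd in hW.
    have -> : psi v - psi u + ep * (v - u) =
      L * h + (cK * eta * (m v - m u) + (e v - e u)) + ep * h by rewrite /psi /h; ring.
    lra.
  have -> : Phi t = x t - sfun_int `[0, t] (s0 n).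
    by rewrite /Phi subrr (coshop0 a0 Oma) (Kop0 OmK OmiK) addr0.
  have -> : Phi 0 = coshop Om t (x 0) + K t (x' 0).
    by rewrite /Phi subr0 sfun_int_itv0// subr0.
  move=> hh; apply: le_trans hh _; rewrite /psi mulr0.
  have := mulr_ge0 (mulr_ge0 cK0 (ltW eta0)) (m0 0); have := e0 0; lra.
rewrite -/L; apply/ler_addgt0Pr => ep ep0.
(* The 2 accounts for the L1 error of [s0 n], which occurs once in [key] and once in passing from
   its integral to [vg]. *)
pose eta := ep / (cK * m t + 2).
have c0 : 0 < cK * m t + 2 by have := mulr_ge0 cK0 (m0 t); lra.
have eta0 : 0 < eta by exact: divr_gt0.
have nn n : (0 <= lint `[0%R, t] (fun r => `|K (t - r) (f r) - sfun_eval (s0 n) r|)%R)%E.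
  by apply: lint_ge0 => r _; exact: normr_ge0.
have cvA : lint `[0, t] (fun r => `|K (t - r) (f r) - sfun_eval (s0 n) r|)
    @[n --> \oo] --> 0%E by exact: cv1.
have [n hn] : exists n,
    (lint `[0%R, t] (fun r => `|K (t - r) (f r) - sfun_eval (s0 n) r|)%R < eta%:E)%E.
  have hh := (cvge0P nn).1 cvA _ eta0.
  by near \oo => n; exists n; near: n.
have fin : lint `[0%R, t] (fun r => `|K (t - r) (f r) - sfun_eval (s0 n) r|)%R \is a fin_num.
  by rewrite ge0_fin_numE//; exact: lt_trans hn (ltry _).
pose en := rint t (fun r => `|K (t - r) (f r) - sfun_eval (s0 n) r|).
have en_eta : en < eta by rewrite -lte_fin /en /rint fineK.
have dist : `|vg - sfun_int `[0, t] (s0 n)| <= en.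
  rewrite -lee_fin /en /rint fineK//; exact: (bochner_dist mt ft gv (ms n)).
have := key eta n eta0; rewrite -/en => hk.
have -> : x t - coshop Om t (x 0) - K t (x' 0) - vg =
  (x t - sfun_int `[0, t] (s0 n) - (coshop Om t (x 0) + K t (x' 0)))
   - (vg - sfun_int `[0, t] (s0 n)).
  by rewrite opprB [X in _ = X + _]addrAC [RHS]addrA subrK opprD addrA.
apply: le_trans (ler_normB _ _) _.
have : eta * (cK * m t + 2) = ep by rewrite /eta divfK// gt_eqF.
lra.
Unshelve. all: by end_near. Qed.

End DelayEstimate.

(** Splits the error into the Duhamel defect and the effect of the changed initial data. *)
Lemma regroup_difference (V : zmodType) (x C K v c k : V) :
  x - (c + k + v) = (x - C - K - v) + ((C - c) + (K - k)).
Proof.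
rewrite [(C - c) + _]addrACA -opprD -[x - C - K]addrA -opprD [RHS]addrA.
by rewrite [x - (C + K) - v + _]addrAC subrK -addrA -opprD [v + _]addrC.
Qed.

Theorem mainTheorem11 (R : realType) (T tau0 a b : R) :
  0 < T -> 0 < tau0 ->
  exists C : R,
  forall (X : completeNormedModType R) (Om : {linear X -> X}) (Omi : X -> X),
    cancel Om Omi -> cancel Omi Om ->
    opnorm_is Om a -> opnorm_is Omi b ->
  forall (x0 x1 : X) (f : R -> X),
    (forall t, 0 <= t -> exists v, bochner f `[0, t] v) ->
  forall xb : R -> X,
    (forall t, 0 <= t -> exists v,
        bochner (fun s => Omi (sinhop Om (t - s) (f s))) `[0, t] v /\
        xb t = coshop Om t x0 + Omi (sinhop Om t x1) + v) ->
  forall tau : R, 0 < tau < tau0 ->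
  forall phi phi' : R -> X, C1on `[- (2 * tau), 0] phi phi' ->
  forall x x' : R -> X, mild_delay Om f tau phi x x' ->
    supnorm 0 T (fun t => x t - xb t) <=
    C * (`|phi (- (2 * tau)) - x0| + `|phi' 0 - x1|
         + tau * (C1norm (- (2 * tau)) 0 phi phi' + L1norm T f)).
Proof.
move=> T0 _.
(* The constant is fixed before the operators appear, so the signs of [a] and [b] are not yet
   known. *)
pose a' : R := `|a|; pose b' : R := `|b|; pose M : R := expR (2 * (T + 1) * a').
pose G := growth_cst T a'.
(* One [M] comes from the initial position and two from the cost 2 tau N of replacing phi(0) by
   phi(-2 tau); [b' * M] comes from the initial velocity, the rest from [duhamel_delay] with B = G
   (N + Q). *)
exists (3 * M + b' * M + 2 * (b' * M * (a' ^+ 2 * G) * T)).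
move=> X Om Omi OmK OmiK [Oma _] [Omib _] x0 x1 f fint xb hxb tau /andP[tau0' _].
move=> phi phi' dphi x x' [dx [xphi sol]].
have a0 : 0 <= a' by exact: normr_ge0.
have b0 : 0 <= b' by exact: normr_ge0.
have M0 : 0 < M by exact: expR_gt0.
have {}Oma y : `|Om y| <= a' * `|y|.
  by apply: le_trans (Oma y) _; rewrite ler_wpM2r// ler_norm.
have {}Omib y : `|Omi y| <= b' * `|y|.
  by apply: le_trans (Omib y) _; rewrite ler_wpM2r// ler_norm.
have p0 : - (2 * tau) < 0 by lra.
have DD0 s : - (2 * tau) <= s <= 0 -> `[- (2 * tau), 0]%classic s.
  by move=> h; rewrite /= in_itv.
have dx0 : C1on `[- (2 * tau), 0] x x'.
  apply: C1on_subset dx => s /=; rewrite !in_itv /= => /andP[-> _] //.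
(* [x'] and [phi'] are separate data, and at 0 the former is a two-sided derivative, the latter
   one-sided; both are compared on the closed history interval. *)
have x'phi s : - (2 * tau) <= s <= 0 -> x' s = phi' s.
  by move=> hs; exact: (C1on_deriv_unique p0 hs dx0 dphi xphi).
have hphi s : - (2 * tau) <= s <= 0 -> `|phi s| <= C1norm (- (2 * tau)) 0 phi phi'.
  move=> hs; rewrite /C1norm le_max; apply/orP; left; apply: le_supnorm => //.
  exact: (C1on_bounded dphi (ltW p0) DD0).
have hphi' s : - (2 * tau) <= s <= 0 -> `|phi' s| <= C1norm (- (2 * tau)) 0 phi phi'.
  move=> hs; rewrite /C1norm le_max; apply/orP; right; apply: le_supnorm => //.
  exact: (C1on_deriv_bounded dphi (ltW p0) DD0).
set N := C1norm _ _ _ _ in hphi hphi' *.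
have mem0 : - (2 * tau) <= (0 : R) <= 0. by apply/andP; split => //; exact: ltW.
have memp : - (2 * tau) <= - (2 * tau) <= 0 by apply/andP; split => //; exact: ltW.
have N0 : 0 <= N by exact: le_trans (normr_ge0 _) (hphi 0 mem0).
set Q := L1norm T f.
have QE : Q = rint T (fun r => `|f r|) by [].
have Q0 : 0 <= Q by rewrite QE; exact: rint_ge0.
have [wT bT] := fint T (ltW T0).
pose B := G * (N + Q).
have hB : forall s, - (2 * tau) <= s <= T -> `|x' s| <= B.
  apply: (delay_growth T0 tau0' a0 N0 Q0 Oma dx).
  - by move=> s hs; rewrite xphi// hphi.
  - by move=> s hs; rewrite x'phi// hphi'.
  move=> t /andP[t0 tT]; have [v [w [bv [bw ->]]]] := sol t t0.
  exists v, w; split => //; apply: le_trans (bochner_norm t0 bw) _.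
  by rewrite QE; apply: le_rint bT; rewrite t0.
have B0 : 0 <= B.
  by apply: le_trans (normr_ge0 (x' 0)) (hB 0 _); apply/andP; split; exact: ltW.
set P := (`|_| + `|_| + _).
apply: ge_sup; first by exists `|x 0 - xb 0|, 0 => //=; rewrite in_itv /= lexx ltW.
move=> z [t /=]; rewrite in_itv /= => tT <-; have /andP[t0 tT'] := tT.
have [v [bv ->]] := hxb t t0.
have S1 : 1 <= T + 1 by lra.
have tS : `|t| <= T + 1 by rewrite ger0_norm//; lra.
have sol' s : 0 <= s -> exists v w,
     [/\ bochner (fun s => x (s - 2 * tau)) `[0, s] v, bochner f `[0, s] w
       & x' s = x' 0 + Om (Om v) + w].
  by move=> /sol[v1 [w1 [? [? ?]]]]; exists v1, w1.
have main := duhamel_delay OmK OmiK a0 Oma b0 Omib tau0' tT B0 dx hB sol' bv.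
have n0 : `|coshop Om t (x 0 - x0)| <= M * `|x 0 - x0|.
  exact: norm_coshop.
have n1 : `|Kop Om Omi t (x' 0 - x1)| <= b' * M * `|x' 0 - x1|.
  exact: norm_Kop.
have C_B y y' : coshop Om t (y - y') = coshop Om t y - coshop Om t y'.
  have := coshop_linear a0 Oma t (-1) y' y; rewrite !scaleN1r => h.
  by rewrite addrC h addrC.
have K_B y y' : Kop Om Omi t (y - y') = Kop Om Omi t y - Kop Om Omi t y'.
  have := Kop_linear OmK OmiK a0 Oma t (-1) y' y; rewrite !scaleN1r => h.
  by rewrite addrC h addrC.
rewrite C_B in n0; rewrite K_B in n1; rewrite -/(Kop Om Omi t x1).
have -> : x t - (coshop Om t x0 + Kop Om Omi t x1 + v) =
  (x t - coshop Om t (x 0) - Kop Om Omi t (x' 0) - v)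
  + ((coshop Om t (x 0) - coshop Om t x0)
     + (Kop Om Omi t (x' 0) - Kop Om Omi t x1)).
  exact: regroup_difference.
have n2 : `|x 0 - x0| <= `|phi (- (2 * tau)) - x0| + N * (2 * tau).
  have h : `|x 0 - x (- (2 * tau))| <= N * (0 - - (2 * tau)).
    apply: (C1on_mvt dx0 (ltW p0)) => // s hs.
    by rewrite x'phi// hphi'.
  rewrite opprK add0r in h; rewrite -(xphi _ memp).
  have := ler_distD (x (- (2 * tau))) (x 0) x0; lra.
rewrite x'phi// in n1; rewrite x'phi// in main *.
apply: le_trans (ler_normD _ _) _.
have h1 := ler_normD (coshop Om t (x 0) - coshop Om t x0)
  (Kop Om Omi t (phi' 0) - Kop Om Omi t x1).
have bM0 : 0 <= b' * M by rewrite mulr_ge0// ltW.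
have n3 : M * `|x 0 - x0| <= M * (`|phi (- (2 * tau)) - x0| + N * (2 * tau)).
  by rewrite ler_pM2l.
have n4 : b' * M * (a' ^+ 2 * (2 * tau * B)) * t <= b' * M * (a' ^+ 2 * (2 * tau * B)) * T.
  rewrite ler_wpM2l//; apply: mulr_ge0 => //; apply: mulr_ge0; first exact: sqr_ge0.
  by apply: mulr_ge0 => //; apply: mulr_ge0 => //; exact: ltW.
have G0 : 0 <= G by apply: growth_cst_ge0 => //; exact: ltW.
have c0 : 0 <= b' * M * (a' ^+ 2 * G) * T.
  by rewrite mulr_ge0 ?(ltW T0)// mulr_ge0// mulr_ge0// sqr_ge0.
have LE : b' * M * (a' ^+ 2 * (2 * tau * B)) * T =
    2 * (b' * M * (a' ^+ 2 * G) * T) * (tau * (N + Q)) by rewrite /B; ring.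
rewrite LE in n4; rewrite -/M in main; rewrite /P.
move: (b' * M * (a' ^+ 2 * G) * T) c0 n4 => c c0 n4.
set p1 := `|phi (- (2 * tau)) - x0| in n3 n2 *; set p2 := `|phi' 0 - x1| in n1 *.
have p10 : 0 <= p1 by exact: normr_ge0.
have p20 : 0 <= p2 by exact: normr_ge0.
have r0 : 0 <= tau * (N + Q) by rewrite mulr_ge0 ?addr_ge0// ltW.
have q1 : 0 <= tau * Q by rewrite mulr_ge0// ltW.
(* These nonnegative products enlarge the coefficient of each data term to the full constant. *)
have := mulr_ge0 (ltW M0) p10; have := mulr_ge0 (ltW M0) p20.
have := mulr_ge0 (ltW M0) r0; have := mulr_ge0 (ltW M0) q1.
have := mulr_ge0 bM0 p10; have := mulr_ge0 bM0 r0.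
have := mulr_ge0 c0 p10; have := mulr_ge0 c0 p20.
lra.
Qed.
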